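(* Let $V$ be an irreducible integrable module for $\mathfrak{L}(A)$. Suppose that the central element $K$ of the affine Lie algebra acts non-trivially on $V$. Then $V$ is a highest weight module or a lowest weight module.
   Context: Everything is over $\mathbb{C}$. $A$ is a finitely generated commutative associative algebra with unit. For a Lie algebra $\mathfrak m$, $\mathfrak m(A):=\mathfrak m\otimes A$ with bracket $[X\otimes a,Y\otimes b]=[X,Y]\otimes ab$. $\overset{\circ}{\mathfrak g}$ is a finite dimensional simple Lie algebra with triangular decomposition $\overset{\circ}{\mathfrak n}_-\oplus\overset{\circ}{\mathfrak h}\oplus\overset{\circ}{\mathfrak n}_+$, root system $\overset{\circ}{\Delta}$, root spaces $\overset{\circ}{\mathfrak g}_\alpha$, and a nondegenerate symmetric invariant bilinear form $\langle\cdot,\cdot\rangle$. Set $\mathfrak g'=\overset{\circ}{\mathfrak g}\otimes\mathbb{C}[t,t^{-1}]\oplus\mathbb{C}K$ with $K$ central and $[x\otimes t^n,y\otimes t^m]=[x,y]\otimes t^{m+n}+m\,\delta_{m,-n}\langle x,y\rangle K$. $\mathrm{Vir}$ has basis $\{d_n,C: n\in\mathbb{Z}\}$ with $C$ central and $[d_n,d_m]=(m-n)d_{n+m}+\delta_{m,-n}\frac{n^3-n}{12}C$. Set $\mathfrak{L}=\mathfrak g'\rtimes\mathrm{Vir}$ with $[d_n,x\otimes t^m]=m\,x\otimes t^{m+n}$, $[d_n,K]=0$, $[C,\mathfrak g']=0$. The loop affine-Virasoro algebra is $\mathfrak{L}(A)=\mathfrak{L}\otimes A$. Let $\bar{\mathfrak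 h}=\overset{\circ}{\mathfrak h}\oplus\mathbb{C}K\oplus\mathbb{C}d_0\oplus\mathbb{C}C$, viewed in $\mathfrak{L}(A)$ as $\bar{\mathfrak h}\otimes 1$. An $\mathfrak{L}(A)$-module $V$ is a weight module if $V=\bigoplus_{\lambda\in\bar{\mathfrak h}^*}V_\lambda$, where $V_\lambda=\{v: hv=\lambda(h)v\ \forall h\in\bar{\mathfrak h}\}$. It is integrable if it is a weight module with all $V_\lambda$ finite dimensional and, for all $\alpha\in\overset{\circ}{\Delta}$, $x\in\overset{\circ}{\mathfrak g}_\alpha$, $n\in\mathbb{Z}$, $a\in A$, the element $(x\otimes t^n)\otimes a$ acts locally nilpotently on $V$. Let $\mathfrak n_\pm=(\overset{\circ}{\mathfrak n}_\pm\otimes 1)\oplus(\overset{\circ}{\mathfrak g}\otimes t^{\pm1}\mathbb{C}[t^{\pm1}])$, $\mathrm{Vir}^{+}=\bigoplus_{n>0}\mathbb{C}d_n$, $\mathrm{Vir}^-=\bigoplus_{n<0}\mathbb{C}d_n$, and $\mathfrak{L}(A)^\pm=(\mathfrak n_\pm\oplus\mathrm{Vir}^\pm)(A)$, $\mathfrak{L}(A)^0=\bar{\mathfrak h}\otimes A$. A weight module $V$ is a highest weight module with highest weight $\lambda$ if there is $0\ne v\in V_\lambda$ with $\mathfrak{L}(A)^+v=0$ and $U(\mathfrak{L}(A))v=V$; lowest weight modules are defined in the same way with $\mathfrak{L}(A)^-$ in place of $\mathfrak{L}(A)^+$. *)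

(* Defs.v *)
From HB Require Import structures.
From mathcomp Require Import all_boot all_order all_algebra.
From mathcomp Require Import sesquilinear ring_quotient generic_quotient.
From mathcomp Require Import finmap.
From mathcomp Require Import boolp classical_sets functions reals complex.
From mathcomp Require Import ring lra zify.

Set Implicit Arguments.
Unset Strict Implicit.
Unset Printing Implicit Defensive.

Import Order.TTheory GRing.Theory Num.Theory.

Local Open Scope classical_set_scope.
Local Open Scope ring_scope.

Definition bilin (K : fieldType) (U W X : lmodType K) (b : U -> W -> X) : Prop :=
  bilinear_for *:%R *:%R b.

Section Bilin.
Variables (K : fieldType) (U W X : lmodType K) (b : U -> W -> X).
Hypothesis bb : bilin b.

Lemma bilinPl a u u' w : b (a *: u + u') w = a *: b u w + b u' w.
Proof. exact: bb.1. Qed.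
Lemma bilinPr a u w w' : b u (a *: w + w') = a *: b u w + b u w'.
Proof. exact: bb.2. Qed.
Lemma bilinDl u u' w : b (u + u') w = b u w + b u' w.
Proof. by rewrite -[u]scale1r bilinPl !scale1r. Qed.
Lemma bilinDr u w w' : b u (w + w') = b u w + b u w'.
Proof. by rewrite -[w]scale1r bilinPr !scale1r. Qed.
Lemma bilin0l w : b 0 w = 0.
Proof. by have := bilinDl 0 0 w; rewrite addr0 => /eqP; rewrite addrC -subr_eq subrr eq_sym => /eqP. Qed.
Lemma bilin0r u : b u 0 = 0.
Proof. by have := bilinDr u 0 0; rewrite addr0 => /eqP; rewrite addrC -subr_eq subrr eq_sym => /eqP. Qed.
Lemma bilinZl a u w : b (a *: u) w = a *: b u w.
Proof. by rewrite -[a *: u]addr0 bilinPl bilin0l addr0. Qed.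
Lemma bilinZr a u w : b u (a *: w) = a *: b u w.
Proof. by rewrite -[a *: w]addr0 bilinPr bilin0r addr0. Qed.
Lemma bilinNl u w : b (- u) w = - b u w.
Proof. by rewrite -scaleN1r bilinZl scaleN1r. Qed.
Lemma bilinNr u w : b u (- w) = - b u w.
Proof. by rewrite -scaleN1r bilinZr scaleN1r. Qed.
End Bilin.

Definition lin_span (K : fieldType) (V : lmodType K) (S : set V) : set V :=
  [set v | exists n (c : 'I_n -> K) (s : 'I_n -> V),
     (forall i, S (s i)) /\ v = \sum_(i < n) c i *: s i].

Section LinSpan.
Variables (K : fieldType) (V : lmodType K).
Implicit Types (S : set V) (P : V -> Prop).

Lemma lin_span_ind S P : P 0 -> (forall a u v, S u -> P v -> P (a *: u + v)) ->
  forall v, lin_span S v -> P v.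
Proof.
move=> P0 PS v [n [c [s [Ss ->]]]].
elim: n c s Ss => [|n IH] c s Ss; first by rewrite big_ord0.
rewrite big_ord_recl; apply: PS; first exact: Ss.
exact: (IH (fun i => c (lift ord0 i)) (fun i => s (lift ord0 i))).
Qed.

Lemma lin_span0 S : lin_span S 0.
Proof. by exists 0%N, (fun=> 0), (fun=> 0); split=> [[]//|]; rewrite big_ord0. Qed.

Lemma lin_spanP S a u v : S u -> lin_span S v -> lin_span S (a *: u + v).
Proof.
move=> Su [n [c [s [Ss ->]]]].
exists n.+1, (fun i => oapp c a (unlift ord0 i)), (fun i => oapp s u (unlift ord0 i)).
split; first by move=> i; case: (unlift ord0 i) => /=.
rewrite big_ord_recl unlift_none /=; congr (_ + _).
by apply: eq_bigr => i _; rewrite liftK.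
Qed.

Lemma sub_lin_span S : S `<=` lin_span S.
Proof.
move=> u Su; rewrite -[u]addr0 -[u]scale1r; apply: lin_spanP => //.
exact: lin_span0.
Qed.

Lemma lin_spanD S u v : lin_span S u -> lin_span S v -> lin_span S (u + v).
Proof.
move=> Su Sv; move: Su; apply: (lin_span_ind (P := fun u => lin_span S (u + v))).
  by rewrite add0r.
by move=> a x y Sx Sy; rewrite -addrA; apply: lin_spanP.
Qed.

Lemma lin_spanZ S a v : lin_span S v -> lin_span S (a *: v).
Proof.
move=> [n [c [s [Ss ->]]]]; exists n, (fun i => a * c i), s; split=> //.
by rewrite scaler_sumr; apply: eq_bigr => i _; rewrite scalerA.
Qed.

End LinSpan.

(* fsmod I U is the direct sum of copies of U indexed by I; in particular
   fsmod int U is U ⊗ K[t, t^-1], with x ⊗ t^n represented by fsmono n x. *)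
Definition fsmod (K : fieldType) (I : choiceType) (U : lmodType K) : Type :=
  {fsfun I -> U with 0}.

Definition fscoef (K : fieldType) (I : choiceType) (U : lmodType K)
  (f : fsmod I U) : I -> U := @fun_of_fsfun I U (fun=> 0) f.
Coercion fscoef : fsmod >-> Funclass.

Definition fssupp (K : fieldType) (I : choiceType) (U : lmodType K)
  (f : fsmod I U) : {fset I} := @finsupp I U (fun=> 0) f.

Section Fsmod.
Variables (K : fieldType) (I : choiceType) (U : lmodType K).
Local Notation M := (@fsmod K I U).

HB.instance Definition _ := Choice.copy M {fsfun I -> U with 0}.


Lemma fscoefP (f g : M) : f =1 g -> f = g.
Proof. by move=> fg; apply/fsfunP. Qed.

Lemma fscoef_dflt (f : M) i : i \notin fssupp f -> f i = 0.
Proof. exact: fsfun_dflt. Qed.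

Lemma mem_fssupp (f : M) i : (i \in fssupp f) = (f i != 0).
Proof. exact: mem_finsupp. Qed.

Definition fsbuild (S : {fset I}) (h : I -> U) : M :=
  [fsfun i in S => h i | 0 : U].

Lemma fsbuildE S h i : fsbuild S h i = if i \in S then h i else 0.
Proof. exact: fsfun_fun. Qed.

Definition fsmod_zero : M := fsbuild (@fset0 I) (fun=> 0).
Definition fsmod_add (f g : M) : M :=
  fsbuild (fssupp f `|` fssupp g)%fset (fun i => f i + g i).
Definition fsmod_opp (f : M) : M := fsbuild (fssupp f) (fun i => - f i).
Definition fsmod_scale (a : K) (f : M) : M := fsbuild (fssupp f) (fun i => a *: f i).

Lemma fsmod_addE f g i : fsmod_add f g i = f i + g i.
Proof.
rewrite fsbuildE in_fsetU !mem_fssupp.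
by case: eqP => [->|] //=; case: eqP => [->|] //=; rewrite addr0.
Qed.
Lemma fsmod_oppE f i : fsmod_opp f i = - f i.
Proof. by rewrite fsbuildE mem_fssupp; case: eqP => [->|] //=; rewrite oppr0. Qed.
Lemma fsmod_scaleE a f i : fsmod_scale a f i = a *: f i.
Proof. by rewrite fsbuildE mem_fssupp; case: eqP => [->|] //=; rewrite scaler0. Qed.
Lemma fsmod_zeroE i : fsmod_zero i = 0.
Proof. by rewrite fsbuildE. Qed.

Fact fsmod_addA : associative fsmod_add.
Proof. by move=> f g h; apply: fscoefP => i; rewrite !fsmod_addE addrA. Qed.
Fact fsmod_addC : commutative fsmod_add.
Proof. by move=> f g; apply: fscoefP => i; rewrite !fsmod_addE addrC. Qed.
Fact fsmod_add0 : left_id fsmod_zero fsmod_add.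
Proof. by move=> f; apply: fscoefP => i; rewrite !fsmod_addE fsmod_zeroE add0r. Qed.
Fact fsmod_addN : left_inverse fsmod_zero fsmod_opp fsmod_add.
Proof.
by move=> f; apply: fscoefP => i; rewrite fsmod_addE fsmod_oppE fsmod_zeroE addNr.
Qed.
HB.instance Definition _ :=
  GRing.isZmodule.Build M fsmod_addA fsmod_addC fsmod_add0 fsmod_addN.

Fact fsmod_scaleA a b f : fsmod_scale a (fsmod_scale b f) = fsmod_scale (a * b) f.
Proof. by apply: fscoefP => i; rewrite !fsmod_scaleE scalerA. Qed.
Fact fsmod_scale1 : left_id 1 fsmod_scale.
Proof. by move=> f; apply: fscoefP => i; rewrite fsmod_scaleE scale1r. Qed.
Fact fsmod_scaleDr : right_distributive fsmod_scale +%R.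
Proof.
by move=> a f g; apply: fscoefP => i;
  rewrite fsmod_scaleE !fsmod_addE !fsmod_scaleE scalerDr.
Qed.
Fact fsmod_scaleDl f : {morph fsmod_scale^~ f : a b / a + b}.
Proof.
by move=> a b; apply: fscoefP => i; rewrite fsmod_scaleE fsmod_addE !fsmod_scaleE scalerDl.
Qed.
HB.instance Definition _ := GRing.Zmodule_isLmodule.Build K M
  fsmod_scaleA fsmod_scale1 fsmod_scaleDr fsmod_scaleDl.

Lemma fsmodD (f g : M) i : fscoef (f + g) i = f i + g i.
Proof. exact: fsmod_addE. Qed.
Lemma fsmodZ a (f : M) i : fscoef (a *: f) i = a *: f i.
Proof. exact: fsmod_scaleE. Qed.
Lemma fsmod0 i : fscoef (0 : M) i = 0.
Proof. exact: fsmod_zeroE. Qed.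

Definition fsmono (i : I) (x : U) : M := fsbuild [fset i]%fset (fun=> x).

Lemma fsmonoE i x j : fsmono i x j = if j == i then x else 0.
Proof. by rewrite fsbuildE in_fset1. Qed.

Lemma fsmonoP i a x y : fsmono i (a *: x + y) = a *: fsmono i x + fsmono i y.
Proof.
apply: fscoefP => j; rewrite fsmodD fsmodZ !fsmonoE.
by case: eqP => //; rewrite scaler0 addr0.
Qed.

Lemma fsmod_sumE (J : Type) (r : seq J) (G : J -> M) i :
  fscoef (\sum_(p <- r) G p) i = \sum_(p <- r) fscoef (G p) i.
Proof. by elim: r => [|p r IH]; rewrite ?big_nil ?fsmod0 // !big_cons fsmodD IH. Qed.

Lemma fsmod_decomp (f : M) : f = \sum_(i <- fssupp f) fsmono i (f i).
Proof.
apply: fscoefP => j; rewrite fsmod_sumE.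
under eq_bigr do rewrite fsmonoE eq_sym.
case: (boolP (j \in fssupp f)) => jf.
  by rewrite -big_mkcond -big_filter filter_pred1_uniq ?fset_uniq // big_seq1.
rewrite fscoef_dflt // big_seq big1 // => i fi; case: eqP => // ij.
by rewrite -ij fi in jf.
Qed.

Variable X : lmodType K.

Definition fssum (F : I -> U -> X) (f : M) : X := \sum_(i <- fssupp f) F i (f i).

Lemma fssum_sub (F : I -> U -> X) (f : M) (S : {fset I}) :
  (forall i, F i 0 = 0) -> (fssupp f `<=` S)%fset ->
  fssum F f = \sum_(i <- S) F i (f i).
Proof.
move=> F0 sfS; rewrite /fssum [RHS](bigID (mem (fssupp f))) /= [X in _ + X]big1 ?addr0.
  rewrite -[RHS]big_filter; apply: perm_big; apply: uniq_perm.
  - exact: fset_uniq.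
  - by rewrite filter_uniq // fset_uniq.
  - move=> i; rewrite mem_filter; case: (boolP (i \in fssupp f)) => //= si.
    by rewrite (fsubsetP sfS _ si).
by move=> i /fscoef_dflt ->.
Qed.

Lemma fssumP (F : I -> U -> X) a (f g : M) :
  (forall i a x y, F i (a *: x + y) = a *: F i x + F i y) ->
  fssum F (a *: f + g) = a *: fssum F f + fssum F g.
Proof.
move=> Flin.
have F0 i : F i 0 = 0.
  have := Flin i 1 0 0; rewrite scaler0 addr0 scale1r => /eqP.
  by rewrite addrC -subr_eq subrr eq_sym => /eqP.
pose S := (fssupp (a *: f + g)%R `|` (fssupp f `|` fssupp g))%fset.
have subS (h : M) : (h \in [:: a *: f + g; f; g]) -> (fssupp h `<=` S)%fset.
  move=> hs; apply/fsubsetP => i hi; move: hs; rewrite !inE => /or3P[]/eqP <-.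
  - by rewrite hi.
  - by rewrite hi orbT.
  - by rewrite hi !orbT.
rewrite (fssum_sub F0 (subS (a *: f + g) _)) ?inE ?eqxx //.
rewrite (fssum_sub F0 (subS f _)) ?inE ?eqxx ?orbT //.
rewrite (fssum_sub F0 (subS g _)) ?inE ?eqxx ?orbT //.
rewrite scaler_sumr -big_split; apply: eq_bigr => i _ /=.
by rewrite fsmodD fsmodZ Flin.
Qed.

Lemma fssum_mono (F : I -> U -> X) i x : (forall i, F i 0 = 0) ->
  fssum F (fsmono i x) = F i x.
Proof.
move=> F0; rewrite (@fssum_sub _ _ [fset i]%fset) //.
  by rewrite big_seq_fset1 fsmonoE eqxx.
apply/fsubsetP => j; rewrite mem_fssupp fsmonoE in_fset1.
by case: (j == i) => //; rewrite eqxx.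
Qed.

End Fsmod.

Definition fssum2 (K : fieldType) (I J : choiceType) (U W X : lmodType K)
    (F : I -> J -> U -> W -> X) (f : fsmod I U) (g : fsmod J W) : X :=
  fssum (fun i x => fssum (fun j y => F i j x y) g) f.

Section Fssum2.
Variables (K : fieldType) (I J : choiceType) (U W X : lmodType K).
Variable F : I -> J -> U -> W -> X.
Hypothesis Fb : forall i j, bilin (F i j).

Lemma fssum2_bilin : bilin (fssum2 F).
Proof.
split=> [g|f] a u v /=.
  apply: fssumP => i b x y; rewrite /fssum scaler_sumr -big_split /=.
  by apply: eq_bigr => j _; rewrite (bilinPl (Fb i j)).
rewrite /fssum2 [fssum (fun i x => fssum _ (_ + _)) _]/fssum.
rewrite scaler_sumr -big_split /=; apply: eq_bigr => i _.
by apply: fssumP => j b x y; rewrite (bilinPr (Fb i j)).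
Qed.

Lemma fssum2_mono i j x y : fssum2 F (fsmono i x) (fsmono j y) = F i j x y.
Proof.
rewrite /fssum2 fssum_mono => [|i'].
  by rewrite fssum_mono // => j'; exact: (bilin0r (Fb _ _)).
by rewrite /fssum big1 // => j' _; exact: (bilin0l (Fb _ _)).
Qed.
End Fssum2.

Section Tensor.
Variables (K : fieldType) (U W : lmodType K).

Local Notation F := (fsmod (U * W)%type (K^o : lmodType K)).
Local Notation e u w := (fsmono (u, w) (1 : K^o) : F).

Definition tensor_rel : set F :=
  [set x | exists a u u' w, x = e (a *: u + u') w - a *: e u w - e u' w] `|`
  [set x | exists a u w w', x = e u (a *: w + w') - a *: e u w - e u w'].

Definition tensor_null (x : F) : bool := `[< lin_span tensor_rel x >].

Fact tensor_null_zmod : zmod_closed tensor_null.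
Proof.
split; first by apply/asboolP; exact: lin_span0.
move=> x y /asboolP Sx /asboolP Sy; apply/asboolP; apply: lin_spanD => //.
by rewrite -scaleN1r; apply: lin_spanZ.
Qed.
HB.instance Definition _ := GRing.isZmodClosed.Build F tensor_null tensor_null_zmod.

Definition tensor_nullc := GRing.ZmodClosed.clone F tensor_null _.

Definition tensor : Type := Quotient.quot tensor_nullc.

HB.instance Definition _ := GRing.Zmodule.copy tensor (Quotient.quot tensor_nullc).

Definition tensor_pi (x : F) : tensor := \pi_(Quotient.quot tensor_nullc)%qT x.
Definition tensor_repr (x : tensor) : F := repr (x : Quotient.quot tensor_nullc).

Lemma tensor_reprK x : tensor_pi (tensor_repr x) = x.
Proof. exact: reprK. Qed.

Lemma tensor_pi_eq x y : tensor_pi x = tensor_pi y <-> lin_span tensor_rel (x - y).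
Proof.
rewrite /tensor_pi; split=> [/eqP|xy].
  by rewrite -Quotient.idealrBE => /asboolP.
by apply/eqP; rewrite -Quotient.idealrBE; apply/asboolP.
Qed.

Lemma tensor_piD x y : tensor_pi (x + y) = tensor_pi x + tensor_pi y.
Proof. exact: (raddfD (\pi_(Quotient.quot tensor_nullc)%qT)). Qed.

Definition tensor_scale (a : K) (x : tensor) : tensor :=
  tensor_pi (a *: tensor_repr x).

Lemma tensor_piZ a x : tensor_pi (a *: x) = tensor_scale a (tensor_pi x).
Proof.
apply/tensor_pi_eq; rewrite -scalerBr; apply: lin_spanZ.
by apply/tensor_pi_eq; rewrite tensor_reprK.
Qed.

Fact tensor_scaleA a b x : tensor_scale a (tensor_scale b x) = tensor_scale (a * b) x.
Proof. by rewrite -[x]tensor_reprK -!tensor_piZ scalerA. Qed.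
Fact tensor_scale1 : left_id 1 tensor_scale.
Proof. by move=> x; rewrite -[x]tensor_reprK -!tensor_piZ scale1r. Qed.
Fact tensor_scaleDr : right_distributive tensor_scale +%R.
Proof.
move=> a x y; rewrite -[x]tensor_reprK -[y]tensor_reprK.
by rewrite -tensor_piD -!tensor_piZ -tensor_piD scalerDr.
Qed.
Fact tensor_scaleDl x : {morph tensor_scale^~ x : a b / a + b}.
Proof.
by move=> a b; rewrite -[x]tensor_reprK -!tensor_piZ -tensor_piD scalerDl.
Qed.
HB.instance Definition _ := GRing.Zmodule_isLmodule.Build K tensor
  tensor_scaleA tensor_scale1 tensor_scaleDr tensor_scaleDl.

Definition pure_tensor (u : U) (w : W) : tensor := tensor_pi (e u w).

Local Lemma tensor_piP a x y : tensor_pi (a *: x + y) = a *: tensor_pi x + tensor_pi y.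
Proof. by rewrite tensor_piD tensor_piZ. Qed.

Lemma pure_tensor_bilin : bilin pure_tensor.
Proof.
split=> [w|u] a x y /=; rewrite /pure_tensor -tensor_piP;
  apply/tensor_pi_eq; apply: sub_lin_span; [left|right].
  by exists a, x, y, w; rewrite opprD addrA.
by exists a, u, x, y; rewrite opprD addrA.
Qed.

Let fsmono_pair (p : U * W) (a : K^o) : fsmono p a = (a : K) *: e p.1 p.2.
Proof.
apply: fscoefP => q; rewrite fsmodZ !fsmonoE -surjective_pairing.
by case: eqP; rewrite ?scaler0 // /GRing.scale /= mulr1.
Qed.

Lemma tensor_span x : lin_span [set y | exists u w, y = pure_tensor u w] x.
Proof.
rewrite -[x]tensor_reprK [tensor_repr x]fsmod_decomp.
elim: (X in \sum_(_ <- X) _) => [|p s IH].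
  rewrite big_nil; have -> : tensor_pi 0 = 0 := raddf0 (\pi_(Quotient.quot tensor_nullc)%qT).
  exact: lin_span0.
by rewrite big_cons fsmono_pair tensor_piP; apply: lin_spanP => //; exists p.1, p.2.
Qed.

Section Lift.
Variables (X : lmodType K) (b : U -> W -> X).

Definition tensor_lift (x : tensor) : X :=
  fssum (fun (p : U * W) (a : K^o) => (a : K) *: b p.1 p.2) (tensor_repr x).

Hypothesis bb : bilin b.

Let ext := fssum (fun (p : U * W) (a : K^o) => (a : K) *: b p.1 p.2).
Let extP a x y : ext (a *: x + y) = a *: ext x + ext y.
Proof.
by apply: fssumP => p c z t; rewrite scalerDl scalerA.
Qed.
Let exte u w : ext (e u w) = b u w.
Proof. by rewrite /ext fssum_mono /= ?scale1r // => p; rewrite scale0r. Qed.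
Let ext0 : ext 0 = 0.
Proof. by have := extP (-1) 0 0; rewrite scaleN1r addNr scaleN1r addNr. Qed.
Let extB x y : ext (x - y) = ext x - ext y.
Proof.
have -> : x - y = -1 *: y + x by rewrite scaleN1r addrC.
by rewrite extP scaleN1r addrC.
Qed.

Let ext_null x : lin_span tensor_rel x -> ext x = 0.
Proof.
elim/lin_span_ind => [//|a u v uR ev]; rewrite extP ev addr0.
suff -> : ext u = 0 by rewrite scaler0.
case: uR => -[c [x1 [x2 [x3 ->]]]]; rewrite -addrA -opprD extB extP !exte.
  by rewrite (bilinPl bb) subrr.
by rewrite (bilinPr bb) subrr.
Qed.

Lemma tensor_lift_pi x : tensor_lift (tensor_pi x) = ext x.
Proof.
apply/eqP; rewrite -subr_eq0 -/(ext _) -extB; apply/eqP; apply: ext_null.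
by apply/tensor_pi_eq; rewrite tensor_reprK.
Qed.

Lemma tensor_liftP a x y :
  tensor_lift (a *: x + y) = a *: tensor_lift x + tensor_lift y.
Proof.
rewrite -[x]tensor_reprK -[y]tensor_reprK -tensor_piP !tensor_lift_pi.
exact: extP.
Qed.

Lemma tensor_liftE u w : tensor_lift (pure_tensor u w) = b u w.
Proof. by rewrite tensor_lift_pi exte. Qed.

End Lift.
End Tensor.

Notation "x ⊗ a" := (pure_tensor x a) (at level 40, left associativity) : ring_scope.

Lemma eq_tensor_lift (K : fieldType) (U W X : lmodType K) (b b' : U -> W -> X) x :
  (forall u w, b u w = b' u w) -> tensor_lift b x = tensor_lift b' x.
Proof. by move=> bb'; apply: eq_bigr => p _; rewrite bb'. Qed.

Lemma tensor_lift_comb (K : fieldType) (U W X : lmodType K) (b b' : U -> W -> X) c x :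
  tensor_lift (fun u w => c *: b u w + b' u w) x
  = c *: tensor_lift b x + tensor_lift b' x.
Proof.
rewrite /tensor_lift /fssum scaler_sumr -big_split /=; apply: eq_bigr => p _.
by rewrite scalerDr !scalerA mulrC.
Qed.

HB.mixin Record Lmodule_isLieAlgebra (K : fieldType) L of GRing.Lmodule K L := {
  lie_bracket : L -> L -> L;
  lie_bilinear : bilin lie_bracket;
  lie_alternating : forall x, lie_bracket x x = 0;
  lie_jacobi : forall x y z,
    lie_bracket x (lie_bracket y z) + lie_bracket y (lie_bracket z x)
    + lie_bracket z (lie_bracket x y) = 0
}.

#[short(type="lieAlgType")]
HB.structure Definition LieAlgebra (K : fieldType) :=
  {L of Lmodule_isLieAlgebra K L & GRing.Lmodule K L}.

#[short(type="finLieAlgType")]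
HB.structure Definition FinLieAlgebra (K : fieldType) :=
  {L of Lmodule_isLieAlgebra K L & Vector K L}.

Notation "[ 'lie' x , y ]" := (lie_bracket x y)
  (at level 0, x, y at level 200, format "[ 'lie'  x ,  y ]") : ring_scope.

Section LieFromGenerators.
Variables (K : fieldType) (L : lmodType K) (br : L -> L -> L) (G : set L).
Hypothesis brb : bilin br.
Hypothesis spanG : forall x, lin_span G x.
Hypothesis altG : forall x, G x -> br x x = 0.
Hypothesis antiG : forall x y, G x -> G y -> br x y = - br y x.
Hypothesis jacG : forall x y z, G x -> G y -> G z ->
  br x (br y z) + br y (br z x) + br z (br x y) = 0.

Lemma gen_anti x y : br x y = - br y x.
Proof.
elim/lin_span_ind: (spanG x) y => [y|a u v Gu IH y].
  by rewrite (bilin0l brb) (bilin0r brb) oppr0.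
rewrite (bilinPl brb) (bilinPr brb) IH opprD; congr (_ - _).
rewrite -scalerN; congr (_ *: _).
elim/lin_span_ind: (spanG y) => [|b u' v' Gu' IH'].
  by rewrite (bilin0l brb) (bilin0r brb) oppr0.
by rewrite (bilinPl brb) (bilinPr brb) IH' opprD antiG // scalerN.
Qed.

Lemma gen_alt x : br x x = 0.
Proof.
elim/lin_span_ind: (spanG x) => [|a u v Gu IH]; first by rewrite (bilin0l brb).
rewrite (bilinPl brb) !(bilinPr brb) altG // scaler0 add0r IH addr0.
by rewrite [br v u]gen_anti scalerN subrr.
Qed.

Let J x y z := br x (br y z) + br y (br z x) + br z (br x y).

Let JP a u v y z : J (a *: u + v) y z = a *: J u y z + J v y z.
Proof.
rewrite /J !(bilinPl brb, bilinPr brb) !scalerDr.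
have E (p q r s t w : L) : p + q + (r + s) + (t + w) = p + r + t + (q + s + w).
  by rewrite [p + q + _]addrACA [LHS]addrACA.
exact: E.
Qed.

Let JC x y z : J x y z = J y z x.
Proof. by rewrite /J [RHS]addrC addrA. Qed.

Lemma gen_jacobi x y z : br x (br y z) + br y (br z x) + br z (br x y) = 0.
Proof.
rewrite -/(J x y z).
have J0 y' z' : J 0 y' z' = 0.
  by rewrite /J !(bilin0l brb, bilin0r brb) !addr0.
elim/lin_span_ind: (spanG x) => [|a u v Gu IH]; first exact: J0.
rewrite JP IH addr0 JC; suff -> : J y z u = 0 by rewrite scaler0.
elim/lin_span_ind: (spanG y) => [|b u' v' Gu' IH']; first exact: J0.
rewrite JP IH' addr0 JC; suff -> : J z u u' = 0 by rewrite scaler0.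
elim/lin_span_ind: (spanG z) => [|c u2 v2 Gu2 IH2]; first exact: J0.
by rewrite JP IH2 addr0 JC /J jacG // scaler0.
Qed.

End LieFromGenerators.

Section LieTheory.
Variables (K : fieldType) (L : lieAlgType K).
Implicit Types x y z : L.

Lemma lie_anti x y : [lie x, y] = - [lie y, x].
Proof.
have := lie_alternating (x + y).
rewrite (bilinDl lie_bilinear) !(bilinDr lie_bilinear) !lie_alternating add0r addr0.
by move/eqP; rewrite addr_eq0 => /eqP.
Qed.

End LieTheory.

Section Current.
Variables (K : fieldType) (L : lieAlgType K) (A : comAlgType K).

Definition current : Type := tensor L A.
HB.instance Definition _ := GRing.Lmodule.copy current (tensor L A).

Definition current_bracket (P Q : current) : current :=
  tensor_lift (fun (X : L) (a : A) =>
    tensor_lift (fun (Y : L) (b : A) => [lie X, Y] ⊗ (a * b) : current) Q) P.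

Let elem (X Y : L) (a b : A) : current := [lie X, Y] ⊗ (a * b).

Let elemPl c X X' Y a b :
  elem (c *: X + X') Y a b = c *: elem X Y a b + elem X' Y a b.
Proof.
by rewrite /elem (bilinPl lie_bilinear) (bilinPl (@pure_tensor_bilin _ _ _)).
Qed.
Let elemPa c X Y a a' b :
  elem X Y (c *: a + a') b = c *: elem X Y a b + elem X Y a' b.
Proof.
by rewrite /elem mulrDl -scalerAl (bilinPr (@pure_tensor_bilin _ _ _)).
Qed.
Let elemPr c X Y Y' a b :
  elem X (c *: Y + Y') a b = c *: elem X Y a b + elem X Y' a b.
Proof.
by rewrite /elem (bilinPr lie_bilinear) (bilinPl (@pure_tensor_bilin _ _ _)).
Qed.
Let elemPb c X Y a b b' :
  elem X Y a (c *: b + b') = c *: elem X Y a b + elem X Y a b'.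
Proof.
by rewrite /elem mulrDr -scalerAr (bilinPr (@pure_tensor_bilin _ _ _)).
Qed.

Let inner_bilin X a : bilin (fun Y b => elem X Y a b).
Proof. by split=> [b|Y] c u v /=; rewrite (elemPr, elemPb). Qed.

Let outer_bilin Q : bilin (fun X a => tensor_lift (fun Y b => elem X Y a b) Q).
Proof.
split=> [a|X] c u v /=; rewrite -tensor_lift_comb; apply: eq_tensor_lift => Y b.
  exact: elemPl.
exact: elemPa.
Qed.

Fact current_bilin : bilin current_bracket.
Proof.
split=> [Q|P] c u v /=; first exact: (tensor_liftP (outer_bilin Q)).
rewrite /current_bracket -tensor_lift_comb; apply: eq_tensor_lift => X a.
exact: (tensor_liftP (inner_bilin X a)).
Qed.

Lemma current_bracketE X Y (a b : A) :
  current_bracket (X ⊗ a) (Y ⊗ b) = [lie X, Y] ⊗ (a * b).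
Proof.
by rewrite /current_bracket (tensor_liftE (outer_bilin _)) (tensor_liftE (inner_bilin _ _)).
Qed.

Let pt := @pure_tensor_bilin K L A.
Let G := [set y : current | exists (u : L) (w : A), y = u ⊗ w].

Fact current_alternating x : current_bracket x x = 0.
Proof.
apply: (gen_alt current_bilin (@tensor_span _ _ _)) => {x} [x [u [a ->]]|].
  by rewrite current_bracketE lie_alternating (bilin0l pt).
move=> x y [u [a ->]] [v [b ->]].
by rewrite !current_bracketE lie_anti (bilinNl pt) mulrC.
Qed.

Fact current_jacobi x y z :
  current_bracket x (current_bracket y z) + current_bracket y (current_bracket z x)
  + current_bracket z (current_bracket x y) = 0.
Proof.
apply: (gen_jacobi current_bilin (@tensor_span _ _ _)) => {x y z}.
move=> x y z [u [a ->]] [v [b ->]] [w [c ->]].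
rewrite !current_bracketE.
have -> : b * (c * a) = a * (b * c) by rewrite [c * a]mulrC mulrCA.
have -> : c * (a * b) = a * (b * c) by rewrite mulrC mulrA.
rewrite -[LHS]/(_ ⊗ _ + _ ⊗ _ + _ ⊗ _ : tensor L A) -!(bilinDl pt).
by rewrite lie_jacobi (bilin0l pt).
Qed.

HB.instance Definition _ := Lmodule_isLieAlgebra.Build K current
  current_bilin current_alternating current_jacobi.

End Current.

Record invariant_form (K : fieldType) (g : lieAlgType K) := InvariantForm {
  iform :> g -> g -> K^o;
  iform_bilin : bilin iform;
  iform_sym : forall x y, iform x y = iform y x;
  iform_inv : forall x y z, iform [lie x, y] z = iform x [lie y, z];
  iform_nondeg : forall x, (forall y, iform x y = 0) -> x = 0
}.

(* The components of a quadruple are the coefficients of the x ⊗ t^n, of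
   the central element of the affine algebra, of the d_n, and of the central
   element of the Virasoro algebra. The form only enters the bracket. *)
Definition affVir (K : fieldType) (g : lieAlgType K) (B : invariant_form g) : Type :=
  (fsmod int g * K^o * fsmod int (K^o : lmodType K) * K^o)%type.

Section AffineVirasoro.
Variables (K : fieldType) (g : lieAlgType K) (B : invariant_form g).
Local Notation affVir := (affVir B).

Local Notation quad := (fsmod int g * K^o * fsmod int (K^o : lmodType K) * K^o)%type.

HB.instance Definition _ := Choice.copy affVir quad.

Definition affVir_add (X Y : affVir) : affVir :=
  (X.1.1.1 + Y.1.1.1, X.1.1.2 + Y.1.1.2, X.1.2 + Y.1.2, X.2 + Y.2).
Definition affVir_opp (X : affVir) : affVir :=
  (- X.1.1.1, - X.1.1.2, - X.1.2, - X.2).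
Definition affVir_zero : affVir := (0, 0, 0, 0).
Definition affVir_scale (a : K) (X : affVir) : affVir :=
  (a *: X.1.1.1, a *: X.1.1.2, a *: X.1.2, a *: X.2).

Fact affVir_addA : associative affVir_add.
Proof. by move=> [[[? ?] ?] ?] [[[? ?] ?] ?] [[[? ?] ?] ?]; congr (_, _, _, _); exact: addrA. Qed.
Fact affVir_addC : commutative affVir_add.
Proof. by move=> [[[? ?] ?] ?] [[[? ?] ?] ?]; congr (_, _, _, _); exact: addrC. Qed.
Fact affVir_add0 : left_id affVir_zero affVir_add.
Proof. by move=> [[[? ?] ?] ?]; congr (_, _, _, _); exact: add0r. Qed.
Fact affVir_addN : left_inverse affVir_zero affVir_opp affVir_add.
Proof. by move=> [[[? ?] ?] ?]; congr (_, _, _, _); exact: addNr. Qed.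
HB.instance Definition _ :=
  GRing.isZmodule.Build affVir affVir_addA affVir_addC affVir_add0 affVir_addN.

Fact affVir_scaleA a b X : affVir_scale a (affVir_scale b X) = affVir_scale (a * b) X.
Proof. by case: X => [[[? ?] ?] ?]; congr (_, _, _, _); exact: scalerA. Qed.
Fact affVir_scale1 : left_id 1 affVir_scale.
Proof. by move=> [[[? ?] ?] ?]; congr (_, _, _, _); exact: scale1r. Qed.
Fact affVir_scaleDr : right_distributive affVir_scale +%R.
Proof. by move=> a [[[? ?] ?] ?] [[[? ?] ?] ?]; congr (_, _, _, _); exact: scalerDr. Qed.
Fact affVir_scaleDl X : {morph affVir_scale^~ X : a b / a + b}.
Proof. by case: X => [[[? ?] ?] ?] a b; congr (_, _, _, _); exact: scalerDl. Qed.
HB.instance Definition _ := GRing.Zmodule_isLmodule.Build K affVir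
  affVir_scaleA affVir_scale1 affVir_scaleDr affVir_scaleDl.

Definition loop_elt (x : g) (n : int) : affVir := (fsmono n x, 0, 0, 0).
Definition affK : affVir := (0, 1, 0, 0).
Definition vird (n : int) : affVir := (0, 0, fsmono n 1, 0).
Definition virC : affVir := (0, 0, 0, 1).

(* In terms of these, [x t^i, y t^j] is given by aff_loop and aff_cocycle,
   [a d_i, y t^j] by vir_loop, [a d_i, b d_j] by vir_witt and vir_cocycle. *)
Definition aff_loop (i j : int) (x y : g) : fsmod int g :=
  fsmono (i + j) [lie x, y].
Definition aff_cocycle (i j : int) (x y : g) : K^o :=
  if j == - i then j%:~R * B x y else 0.
Definition vir_loop (i j : int) (a : K^o) (y : g) : fsmod int g :=
  fsmono (i + j) ((a * j%:~R : K) *: y).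
Definition vir_witt (i j : int) (a b : K^o) : fsmod int (K^o : lmodType K) :=
  fsmono (i + j) ((j - i)%:~R * (a * b)).
Definition vir_cocycle (i j : int) (a b : K^o) : K^o :=
  if j == - i then (i ^+ 3 - i)%:~R / 12%:R * (a * b) else 0.

Definition affVir_bracket (X Y : affVir) : affVir :=
  let: (f, _, p, _) := X in
  let: (f', _, p', _) := Y in
  (fssum2 aff_loop f f' + fssum2 vir_loop p f' - fssum2 vir_loop p' f,
   fssum2 aff_cocycle f f',
   fssum2 vir_witt p p',
   fssum2 vir_cocycle p p').

Let KoZ (a : K) (b : K^o) : a *: b = a * b :> K.
Proof. by []. Qed.

Let lieb := @lie_bilinear K g.

Fact aff_loop_bilin i j : bilin (aff_loop i j).
Proof.
by split=> [y|x] a u v /=; rewrite /aff_loop -fsmonoP (bilinPl lieb, bilinPr lieb).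
Qed.
Fact vir_loop_bilin i j : bilin (vir_loop i j).
Proof.
split=> [y|x] a u v /=; rewrite /vir_loop -fsmonoP.
  by rewrite KoZ mulrDl scalerDl scalerA mulrA.
by rewrite scalerDr !scalerA [a * _]mulrC.
Qed.
Fact aff_cocycle_bilin i j : bilin (aff_cocycle i j).
Proof.
split=> [y|x] a u v /=; rewrite /aff_cocycle; case: ifP => _;
  rewrite ?scaler0 ?addr0 //.
  by rewrite (bilinPl (iform_bilin B)) !KoZ; ring.
by rewrite (bilinPr (iform_bilin B)) !KoZ; ring.
Qed.
Fact vir_witt_bilin i j : bilin (vir_witt i j).
Proof.
by split=> [y|x] a u v /=; rewrite /vir_witt -fsmonoP; congr fsmono; rewrite !KoZ; ring.
Qed.
Fact vir_cocycle_bilin i j : bilin (vir_cocycle i j).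
Proof.
split=> [y|x] a u v /=; rewrite /vir_cocycle; case: ifP => _;
  rewrite ?scaler0 ?addr0 //; rewrite !KoZ; ring.
Qed.

Let b1 := fssum2_bilin aff_loop_bilin.
Let b2 := fssum2_bilin vir_loop_bilin.
Let b3 := fssum2_bilin aff_cocycle_bilin.
Let b4 := fssum2_bilin vir_witt_bilin.
Let b5 := fssum2_bilin vir_cocycle_bilin.

Fact affVir_bilin : bilin affVir_bracket.
Proof.
have E (V : lmodType K) (a : K) (x1 x2 y1 y2 z1 z2 : V) :
    a *: x1 + x2 + (a *: y1 + y2) - (a *: z1 + z2)
    = a *: (x1 + y1 - z1) + (x2 + y2 - z2).
  by rewrite [a *: x1 + x2 + _]addrACA opprD [LHS]addrACA scalerBr scalerDr.
split=> [[[[f' k'] p'] c']|[[[f k] p] c]] a.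
  move=> [[[f1 k1] q1] c1] [[[f2 k2] q2] c2] /=.
  rewrite (bilinPl b1) (bilinPl b2) (bilinPr b2) E.
  by rewrite (bilinPl b3) (bilinPl b4) (bilinPl b5).
move=> [[[f1 k1] q1] c1] [[[f2 k2] q2] c2] /=.
rewrite (bilinPr b1) (bilinPr b2) (bilinPl b2) E.
by rewrite (bilinPr b3) (bilinPr b4) (bilinPr b5).
Qed.

Let bs0 := (bilin0l b1, bilin0r b1, bilin0l b2, bilin0r b2, bilin0l b3, bilin0r b3,
            bilin0l b4, bilin0r b4, bilin0l b5, bilin0r b5).

Lemma quad_eq (X Y : affVir) :
  X.1.1.1 = Y.1.1.1 -> X.1.1.2 = Y.1.1.2 -> X.1.2 = Y.1.2 -> X.2 = Y.2 -> X = Y.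
Proof. by case: X Y => [[[? ?] ?] ?] [[[? ?] ?] ?] /= -> -> -> ->. Qed.

Local Notation br := affVir_bracket.

Lemma loop_eltP n a x y : loop_elt (a *: x + y) n = a *: loop_elt x n + loop_elt y n.
Proof. by apply: quad_eq; rewrite /= ?fsmonoP ?scaler0 ?addr0. Qed.

Lemma br_affKl X : br affK X = 0.
Proof. by case: X => [[[f k] p] c]; rewrite /br /= !bs0 addr0 subr0. Qed.
Lemma br_affKr X : br X affK = 0.
Proof. by case: X => [[[f k] p] c]; rewrite /br /= !bs0 addr0 subr0. Qed.
Lemma br_virCl X : br virC X = 0.
Proof. by case: X => [[[f k] p] c]; rewrite /br /= !bs0 addr0 subr0. Qed.
Lemma br_virCr X : br X virC = 0.
Proof. by case: X => [[[f k] p] c]; rewrite /br /= !bs0 addr0 subr0. Qed.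

Lemma br_loop_loop x y n m :
  br (loop_elt x n) (loop_elt y m)
  = loop_elt [lie x, y] (n + m) + (if m == - n then m%:~R * B x y else 0 : K) *: affK.
Proof.
apply: quad_eq; rewrite /= ?bs0 ?(fssum2_mono aff_loop_bilin)
  ?(fssum2_mono aff_cocycle_bilin) ?scaler0 ?addr0 ?subr0 ?add0r //.
by rewrite KoZ mulr1.
Qed.

Lemma br_vird_loop n y m : br (vird n) (loop_elt y m) = m%:~R *: loop_elt y (n + m).
Proof.
apply: quad_eq; rewrite /= ?bs0 ?(fssum2_mono vir_loop_bilin) ?scaler0 ?add0r ?subr0 //.
by rewrite /vir_loop mul1r -[_ *: y]addr0 fsmonoP -[RHS]addr0; congr (_ + _);
   apply: fscoefP => i; rewrite fsmonoE fsmod0; case: eqP.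
Qed.

Lemma br_loop_vird n y m : br (loop_elt y m) (vird n) = - m%:~R *: loop_elt y (n + m).
Proof.
rewrite scaleNr -br_vird_loop.
by apply: quad_eq; rewrite /= ?bs0 ?addr0 ?add0r ?subr0 ?oppr0.
Qed.

Lemma br_vird_vird n m :
  br (vird n) (vird m) = (m - n)%:~R *: vird (n + m)
    + (if m == - n then (n ^+ 3 - n)%:~R / 12%:R else 0 : K) *: virC.
Proof.
apply: quad_eq; rewrite /= ?bs0 ?(fssum2_mono vir_witt_bilin)
  ?(fssum2_mono vir_cocycle_bilin) ?scaler0 ?addr0 ?subr0 ?add0r //.
  apply: fscoefP => i; rewrite fsmodZ !fsmonoE; case: eqP; rewrite ?scaler0 //.
  by rewrite KoZ !mulr1.
by rewrite /vir_cocycle; case: ifP => _; rewrite KoZ ?mulr1 // ?mul0r.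
Qed.

Definition affVir_gen : set affVir :=
  [set X | (exists x n, X = loop_elt x n) \/ X = affK \/ (exists n, X = vird n)
           \/ X = virC].

Lemma affVir_span X : lin_span affVir_gen X.
Proof.
case: X => [[[f k] p] c].
have -> : (f, k, p, c) = (f, 0, 0, 0) + (k : K) *: affK + (0, 0, p, 0)
                          + (c : K) *: virC :> affVir.
  by apply: quad_eq; rewrite /= ?scaler0 ?addr0 ?add0r // KoZ mulr1.
apply: lin_spanD; last first.
  by apply/lin_spanZ/sub_lin_span; do 3!right.
apply: lin_spanD.
  apply: lin_spanD; last by apply/lin_spanZ/sub_lin_span; right; left.
  rewrite [f]fsmod_decomp.
  elim: (X in \sum_(_ <- X) _) => [|i s IH].
    by rewrite big_nil; exact: lin_span0.
  rewrite big_cons; have -> (u v : fsmod int g) :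
      (u + v, 0, 0, 0) = (u, 0, 0, 0) + (v, 0, 0, 0) :> affVir.
    by apply: quad_eq; rewrite /= ?addr0.
  by apply: lin_spanD => //; apply: sub_lin_span; left; exists (f i), i.
rewrite [p]fsmod_decomp.
elim: (X in \sum_(_ <- X) _) => [|i s IH].
  by rewrite big_nil; exact: lin_span0.
rewrite big_cons; have -> (u v : fsmod int (K^o : lmodType K)) :
    (0, 0, u + v, 0) = (0, 0, u, 0) + (0, 0, v, 0) :> affVir.
  by apply: quad_eq; rewrite /= ?addr0.
apply: lin_spanD => //.
have -> : (0, 0, fsmono i (p i), 0) = (p i : K) *: vird i :> affVir.
  apply: quad_eq; rewrite /= ?scaler0 //.
  apply: fscoefP => j; rewrite fsmodZ !fsmonoE.
  by case: eqP; rewrite ?scaler0 // KoZ mulr1.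
by apply/lin_spanZ/sub_lin_span; right; right; left; exists i.
Qed.

Let gen_antiE : forall X Y, affVir_gen X -> affVir_gen Y -> br X Y = - br Y X.
Proof.
move=> X Y [[x [n ->]]|[->|[[n ->]|->]]] [[y [m ->]]|[->|[[m ->]|->]]];
  rewrite ?br_affKl ?br_affKr ?br_virCl ?br_virCr ?oppr0 //.
- rewrite !br_loop_loop opprD lie_anti [n + m]addrC; congr (_ + _).
    by rewrite -[- [lie _, _]]addr0 -scaleN1r loop_eltP scaleN1r -[RHS]addr0;
       congr (_ + _); apply: quad_eq => //=; apply: fscoefP => i;
       rewrite fsmonoE fsmod0; case: eqP.
  rewrite -scaleNr; congr (_ *: _).
  rewrite [m == - n]eq_sym eqr_oppLR; case: eqP => [->|_]; last by rewrite oppr0.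
  by rewrite mulrNz iform_sym mulNr opprK.
- by rewrite br_loop_vird br_vird_loop scaleNr.
- by rewrite br_loop_vird br_vird_loop scaleNr opprK.
- rewrite !br_vird_vird opprD -!scaleNr [n + m]addrC -mulrNz opprB.
  congr (_ + _ *: _).
  rewrite [m == - n]eq_sym eqr_oppLR; case: eqP => [->|_]; last by rewrite oppr0.
  by rewrite -mulNr -mulrNz; congr (_%:~R / _); ring.
Qed.

Let gen_altE X : affVir_gen X -> br X X = 0.
Proof.
move=> [[x [n ->]]|[->|[[n ->]|->]]]; rewrite ?br_affKl ?br_virCl //.
- rewrite br_loop_loop lie_alternating.
  have -> : loop_elt 0 (n + n) = 0.
    by apply: quad_eq => //=; apply: fscoefP => i; rewrite fsmonoE fsmod0; case: eqP.
  rewrite add0r; case: eqP => [nN|_]; last by rewrite scale0r.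
  have -> : n = 0 by lia.
  by rewrite mul0r scale0r.
- rewrite br_vird_vird subrr scale0r add0r; case: eqP => [nN|_]; last by rewrite scale0r.
  have -> : n = 0 by lia.
  by rewrite expr0n subrr mul0r scale0r.
Qed.

Let loopZ a x n : loop_elt (a *: x) n = a *: loop_elt x n.
Proof.
have l0 : loop_elt 0 n = 0.
  by apply: quad_eq => //=; apply: fscoefP => i; rewrite fsmonoE fsmod0; case: eqP.
by rewrite -[a *: x]addr0 loop_eltP l0 addr0.
Qed.
Let loopD x y n : loop_elt (x + y) n = loop_elt x n + loop_elt y n.
Proof. by rewrite -[x in LHS]scale1r loop_eltP scale1r. Qed.

Let brl := affVir_bilin.

Let br_loop3 x y z n m k :
  br (loop_elt x n) (br (loop_elt y m) (loop_elt z k))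
  = loop_elt [lie x, [lie y, z]] (n + m + k)
    + (if n + m + k == 0 then - n%:~R * B x [lie y, z] else 0 : K) *: affK.
Proof.
rewrite br_loop_loop (bilinDr brl) (bilinZr brl) br_affKr scaler0 addr0.
rewrite br_loop_loop addrA; congr (_ + _ *: _).
have -> : (m + k == - n) = (n + m + k == 0) by lia.
case: eqP => // E; have -> : m + k = - n by lia.
by rewrite mulrNz.
Qed.

Let br_dll x y l n m :
  br (vird l) (br (loop_elt x n) (loop_elt y m))
  = (n + m)%:~R *: loop_elt [lie x, y] (l + n + m).
Proof.
by rewrite br_loop_loop (bilinDr brl) (bilinZr brl) br_affKr scaler0 addr0 br_vird_loop addrA.
Qed.

Let br_lld x y l n m :
  br (loop_elt x n) (br (loop_elt y m) (vird l))
  = - m%:~R *: loop_elt [lie x, y] (l + n + m)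
    + (if l + n + m == 0 then m%:~R * n%:~R * B x y else 0 : K) *: affK.
Proof.
rewrite br_loop_vird (bilinZr brl) br_loop_loop scalerDr scalerA.
have -> : n + (l + m) = l + n + m by ring.
congr (_ + _ *: _).
have -> : (l + m == - n) = (l + n + m == 0) by lia.
case: eqP => [E|_]; last by rewrite mulr0.
have -> : l + m = - n by lia.
by rewrite mulrNz mulrA mulrNN.
Qed.

Let br_ldl x y l n m :
  br (loop_elt y m) (br (vird l) (loop_elt x n))
  = n%:~R *: loop_elt [lie y, x] (l + n + m)
    + (if l + n + m == 0 then - (m%:~R * n%:~R) * B x y else 0 : K) *: affK.
Proof.
rewrite br_vird_loop (bilinZr brl) br_loop_loop scalerDr scalerA.
have -> : m + (l + n) = l + n + m by ring.
congr (_ + _ *: _).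
have -> : (l + n == - m) = (l + n + m == 0) by lia.
case: eqP => [E|_]; last by rewrite mulr0.
have -> : l + n = - m by lia.
by rewrite mulrNz mulrA mulrN iform_sym [m%:~R * _]mulrC.
Qed.

Let jac_dll x y l n m :
  br (vird l) (br (loop_elt x n) (loop_elt y m))
  + br (loop_elt x n) (br (loop_elt y m) (vird l))
  + br (loop_elt y m) (br (vird l) (loop_elt x n)) = 0.
Proof.
rewrite br_dll br_lld br_ldl.
have -> : loop_elt [lie y, x] (l + n + m) = -1 *: loop_elt [lie x, y] (l + n + m).
  by rewrite -loopZ scaleN1r -lie_anti.
set v := loop_elt _ _; rewrite scalerA [_ *: v + (_ + _)]addrA [LHS]addrACA -!scalerDl.
have -> : (n + m)%:~R - m%:~R + n%:~R * -1 = 0 :> K by rewrite rmorphD /=; ring.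
rewrite scale0r add0r; case: ifP => _; last by rewrite addr0 scale0r.
by rewrite mulNr subrr scale0r.
Qed.

Let jac_ddl x l k n :
  br (vird l) (br (vird k) (loop_elt x n))
  + br (vird k) (br (loop_elt x n) (vird l))
  + br (loop_elt x n) (br (vird l) (vird k)) = 0.
Proof.
rewrite br_vird_vird (bilinDr brl) !(bilinZr brl) br_virCr scaler0 addr0.
rewrite !br_loop_vird br_vird_loop !(bilinZr brl) !br_vird_loop !scalerA.
have -> : k + (l + n) = l + k + n by ring.
rewrite addrA -!scalerDl !rmorphD /= rmorphN /=.
suff -> : n%:~R * (k%:~R + n%:~R) + - n%:~R * (l%:~R + n%:~R)
          + (k%:~R - l%:~R) * - n%:~R = 0 :> K by rewrite scale0r.
by ring.
Qed.

Let br_ddd n m k :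
  br (vird n) (br (vird m) (vird k))
  = ((k - m) * (m + k - n))%:~R *: vird (n + m + k)
    + (if n + m + k == 0 then ((k - m) * (n ^+ 3 - n))%:~R / 12%:R else 0 : K) *: virC.
Proof.
rewrite br_vird_vird (bilinDr brl) !(bilinZr brl) br_virCr scaler0 addr0.
rewrite br_vird_vird scalerDr !scalerA -intrM addrA; congr (_ + _ *: _).
have -> : (m + k == - n) = (n + m + k == 0) by lia.
by case: eqP => _; rewrite ?mulr0 // mulrA -intrM.
Qed.

Let addACA3 (p q r s t w : affVir) :
  p + q + (r + s) + (t + w) = p + r + t + (q + s + w).
Proof. by rewrite [p + q + _]addrACA [LHS]addrACA. Qed.

Let jac_ddd n m k :
  br (vird n) (br (vird m) (vird k)) + br (vird m) (br (vird k) (vird n))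
  + br (vird k) (br (vird n) (vird m)) = 0.
Proof.
rewrite !br_ddd.
have -> : m + k + n = n + m + k by ring.
have -> : k + n + m = n + m + k by ring.
rewrite addACA3 -!scalerDl -!intrD.
have -> : (k - m) * (m + k - n) + (n - k) * (k + n - m) + (m - n) * (n + m - k) = 0
  by ring.
rewrite scale0r add0r; case: eqP => [E|_]; last by rewrite !addr0 scale0r.
rewrite -!mulrDl -!intrD.
have -> : (k - m) * (n ^+ 3 - n) + (n - k) * (m ^+ 3 - m) + (m - n) * (k ^+ 3 - k) = 0.
  have -> : k = - (n + m) by lia.
  by ring.
by rewrite mul0r scale0r.
Qed.

Let jac_lll x y z n m k :
  br (loop_elt x n) (br (loop_elt y m) (loop_elt z k))
  + br (loop_elt y m) (br (loop_elt z k) (loop_elt x n))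
  + br (loop_elt z k) (br (loop_elt x n) (loop_elt y m)) = 0.
Proof.
rewrite !br_loop3.
have -> : m + k + n = n + m + k by ring.
have -> : k + n + m = n + m + k by ring.
rewrite addACA3 -!scalerDl -!loopD lie_jacobi.
rewrite -[X in loop_elt X](scale0r 0) loopZ scale0r add0r.
case: eqP => [E|_]; last by rewrite !addr0 scale0r.
have <- : B y [lie z, x] = B x [lie y, z] by rewrite iform_sym -iform_inv iform_sym -?iform_inv iform_sym -iform_inv iform_sym.
have <- : B y [lie z, x] = B z [lie x, y] by rewrite -iform_inv iform_sym -iform_inv iform_sym.
rewrite -!mulrDl -!opprD -!intrD E.
by rewrite oppr0 mul0r scale0r.
Qed.

Let gen_jacE X Y Z : affVir_gen X -> affVir_gen Y -> affVir_gen Z ->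
  br X (br Y Z) + br Y (br Z X) + br Z (br X Y) = 0.
Proof.
pose J X Y Z := br X (br Y Z) + br Y (br Z X) + br Z (br X Y).
have JC U V W : J U V W = J V W U by rewrite /J [RHS]addrC addrA.
have JK V W : J affK V W = 0.
  by rewrite /J br_affKl br_affKr br_affKl !(bilin0r brl) !addr0.
have JVC V W : J virC V W = 0.
  by rewrite /J br_virCl br_virCr br_virCl !(bilin0r brl) !addr0.
rewrite -/(J X Y Z).
move=> [[x [n ->]]|[->|[[n ->]|->]]]; rewrite ?JK ?JVC //;
move=> [[y [m ->]]|[->|[[m ->]|->]]]; rewrite ?JK ?JVC // JC ?JK ?JVC //;
move=> [[z [k ->]]|[->|[[k ->]|->]]]; rewrite JC ?JK ?JVC // JC.
- exact: jac_lll.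
- by rewrite -JC; exact: jac_dll.
- by rewrite JC; exact: jac_dll.
- by rewrite JC; exact: jac_ddl.
- exact: jac_dll.
- by rewrite -JC; exact: jac_ddl.
- exact: jac_ddl.
- exact: jac_ddd.
Qed.

Fact affVir_alternating X : br X X = 0.
Proof. exact: (gen_alt affVir_bilin affVir_span gen_altE gen_antiE). Qed.

Fact affVir_jacobi X Y Z : br X (br Y Z) + br Y (br Z X) + br Z (br X Y) = 0.
Proof. exact: (gen_jacobi affVir_bilin affVir_span gen_jacE). Qed.

HB.instance Definition _ := Lmodule_isLieAlgebra.Build K affVir
  affVir_bilin affVir_alternating affVir_jacobi.

End AffineVirasoro.

Definition lie_ideal (K : fieldType) (g : finLieAlgType K) (I : {vspace g}) : Prop :=
  forall x y : g, y \in I -> [lie x, y] \in I.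

Definition simple_lie (K : fieldType) (g : finLieAlgType K) : Prop :=
  (exists x y : g, [lie x, y] != 0) /\
  (forall I : {vspace g}, lie_ideal I -> I = 0%VS \/ I = fullv).

Section Roots.
Variables (K : fieldType) (g : finLieAlgType K) (h : {vspace g}).
Local Notation hdual := 'Hom(subvs_of h, K^o).

Definition root_space (alpha : hdual) : set g :=
  [set x | forall u : subvs_of h, [lie vsval u, x] = (alpha u : K) *: x].

Definition is_root (alpha : hdual) : Prop :=
  alpha != 0 /\ exists x, x != 0 /\ root_space alpha x.

Definition nneg_comb (s : seq hdual) (alpha : hdual) : Prop :=
  exists c : 'I_(size s) -> nat, alpha = \sum_(i < size s) s`_i *+ c i.

(* s is a base of the root system: a basis of the dual of h consisting of
   roots, such that every root is an integer combination of s with all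
   coefficients of the same sign *)
Definition root_base (s : seq hdual) : Prop :=
  [/\ basis_of fullv s,
      forall alpha, alpha \in s -> is_root alpha
    & forall alpha, is_root alpha -> nneg_comb s alpha \/ nneg_comb s (- alpha)].

Definition positive_root (s : seq hdual) (alpha : hdual) : Prop :=
  is_root alpha /\ nneg_comb s alpha.
Definition negative_root (s : seq hdual) (alpha : hdual) : Prop :=
  is_root alpha /\ nneg_comb s (- alpha).

End Roots.

(* td_h is then a Cartan subalgebra: it is abelian, acts diagonalizably on g,
   and its zero weight space is itself. *)
Record triangular_decomposition (K : fieldType) (g : finLieAlgType K) :=
  TriangularDecomposition {
  td_h : {vspace g};
  td_nneg : {vspace g};
  td_npos : {vspace g};
  td_base : seq 'Hom(subvs_of td_h, K^o);
  td_abelian : forall x y, x \in td_h -> y \in td_h -> [lie x, y] = 0;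
  td_baseP : root_base td_base;
  td_nposP : forall x, x \in td_npos <->
    lin_span [set y | exists alpha, positive_root td_base alpha /\
                                    root_space alpha y] x;
  td_nnegP : forall x, x \in td_nneg <->
    lin_span [set y | exists alpha, negative_root td_base alpha /\
                                    root_space alpha y] x;
  td_sum : (td_nneg + td_h + td_npos)%VS = fullv;
  td_direct : directv (td_nneg + td_h + td_npos)%VS
}.

Record lie_module (K : fieldType) (L : lieAlgType K) (V : lmodType K) := LieModule {
  lact :> L -> V -> V;
  lact_bilin : bilin lact;
  lact_bracket : forall x y v,
    lact [lie x, y] v = lact x (lact y v) - lact y (lact x v)
}.

Section Modules.
Variables (K : fieldType) (L : lieAlgType K) (V : lmodType K) (rho : lie_module L V).

Definition submodule (W : set V) : Prop :=
  [/\ W 0, forall a u v, W u -> W v -> W (a *: u + v)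
    & forall x v, W v -> W (rho x v)].

Definition irreducible : Prop :=
  (exists v : V, v != 0) /\
  (forall W, submodule W -> W = [set 0] \/ W = setT).

(* U(L) v, as U(L) is spanned by the monomials x_1 ... x_k in elements of L *)
Definition cyclic_submodule (v : V) : set V :=
  lin_span [set w | exists s : seq L, w = foldr rho v s].

Definition locally_nilpotent (x : L) : Prop :=
  forall v, exists k, iter k (rho x) v = 0.

End Modules.

Definition fin_dim (K : fieldType) (V : lmodType K) (W : set V) : Prop :=
  exists s : seq V, W `<=` lin_span [set` s].

Definition is_direct_sum (K : fieldType) (V : lmodType K) (I : choiceType)
    (W : I -> set V) : Prop :=
  (forall v, exists (s : seq I) (w : I -> V),
     (forall i, W i (w i)) /\ v = \sum_(i <- s) w i) /\
  (forall (s : seq I) (w : I -> V), uniq s -> (forall i, W i (w i)) ->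
     \sum_(i <- s) w i = 0 -> forall i, i \in s -> w i = 0).

Definition finitely_generated (K : fieldType) (A : comAlgType K) : Prop :=
  exists s : seq A, forall a,
    lin_span [set b | exists e : 'I_(size s) -> nat,
                        b = \prod_(i < size s) s`_i ^+ e i] a.

Section LoopAffVir.
Variables (K : fieldType) (g : finLieAlgType K) (B : invariant_form g).
Variables (td : triangular_decomposition g) (A : comAlgType K).

Definition loop_affVir : lieAlgType K := current (affVir B) A.

(* The coordinates are those of td_h, and of K, d_0 and C. *)
Definition hbar : Type := (subvs_of (td_h td) * K^o * K^o * K^o)%type.
HB.instance Definition _ := Vector.copy hbar
  (subvs_of (td_h td) * K^o * K^o * K^o)%type.

Definition hbar_elt (u : hbar) : affVir B :=
  loop_elt B (vsval u.1.1.1) 0 + (u.1.1.2 : K) *: affK B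
  + (u.1.2 : K) *: vird B 0 + (u.2 : K) *: virC B.

(* n_+ ⊕ Vir^+ and n_- ⊕ Vir^- *)
Definition affVir_pos : set (affVir B) :=
  lin_span ([set X | exists2 x, x \in td_npos td & X = loop_elt B x 0] `|`
            [set X | exists x n, 0 < n /\ X = loop_elt B x n] `|`
            [set X | exists n, 0 < n /\ X = vird B n]).
Definition affVir_neg : set (affVir B) :=
  lin_span ([set X | exists2 x, x \in td_nneg td & X = loop_elt B x 0] `|`
            [set X | exists x n, n < 0 /\ X = loop_elt B x n] `|`
            [set X | exists n, n < 0 /\ X = vird B n]).

Definition current_of (S : set (affVir B)) : set loop_affVir :=
  lin_span [set y : loop_affVir | exists X (a : A), S X /\ y = X ⊗ a].

Definition loop_affVir_pos : set loop_affVir := current_of affVir_pos.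
Definition loop_affVir_neg : set loop_affVir := current_of affVir_neg.

Variables (V : lmodType K) (rho : lie_module loop_affVir V).

Definition weight_space (lambda : 'Hom(hbar, K^o)) : set V :=
  [set v | forall u : hbar, rho (hbar_elt u ⊗ (1 : A)) v = (lambda u : K) *: v].

Definition weight_module : Prop := is_direct_sum weight_space.

Definition integrable : Prop :=
  [/\ weight_module,
      forall lambda, fin_dim (weight_space lambda)
    & forall (alpha : 'Hom(subvs_of (td_h td), K^o)) x n (a : A),
        is_root alpha -> root_space alpha x ->
        locally_nilpotent rho (loop_elt B x n ⊗ a)].

Definition extremal_weight_module (N : set loop_affVir) : Prop :=
  weight_module /\
  exists (lambda : 'Hom(hbar, K^o)) (v : V),
    [/\ v != 0, weight_space lambda v, forall x, N x -> rho x v = 0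
      & cyclic_submodule rho v = setT].

Definition highest_weight_module : Prop := extremal_weight_module loop_affVir_pos.
Definition lowest_weight_module : Prop := extremal_weight_module loop_affVir_neg.

End LoopAffVir.

(* Main.v *)
(* Only the set of weights matters.  For a root al and an integer n, root
   vectors of weights al + n delta and -(al + n delta) span an sl_2 acting
   locally nilpotently, and at the weight mu its coroot takes the value
   mu(al^vee) - n m, where m <> 0 is proportional to the level.  So the strings
   through a weight are long in the directions al + n delta with - n m large.
   Combined with nilpotency on the finite dimensional V_mu, this shows that for
   a sign eps, depending on the level alone, mu + N eps delta is a weight for
   finitely many N > 0 only.  When |mu(al^vee)| is large, moving along a string
   from mu to mu + eps delta -+ al decreases the norm of the finite part for the
   trace form of g and increases N D + eps height, where N is the coefficient
   of eps delta and the constant D exceeds the heights of all roots; such moves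
   end in a finite box of finite parts.  Hence this functional is bounded on the
   weights, and a weight maximizing it is killed by L(A)^+ or L(A)^-, according
   to eps. *)
Require Import Defs.
From HB Require Import structures.
From mathcomp Require Import all_boot all_order all_algebra.
From mathcomp Require Import boolp classical_sets reals complex.
From mathcomp Require Import ring lra zify.

Set Implicit Arguments.
Unset Strict Implicit.
Unset Printing Implicit Defensive.

Import Order.TTheory GRing.Theory Num.Theory.
Local Open Scope classical_set_scope.
Local Open Scope ring_scope.

(** * Ladders of two operators with scalar commutators, covering the sl_2 and Heisenberg cases *)

Section Ladder.
Variables (K : fieldType) (V : lmodType K) (X Y : {linear V -> V}).
Variables (v : V) (s : nat -> K).
Hypotheses (Xv : X v = 0)
  (XYv : forall j, X (Y (iter j Y v)) - Y (X (iter j Y v)) = s j *: iter j Y v).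

Lemma ladder_step j :
  X (iter j.+1 Y v) = (\sum_(i < j.+1) s i) *: iter j Y v.
Proof.
elim: j => [|j IH]; first by rewrite big_ord1 -(XYv 0) /= Xv linear0 subr0.
rewrite big_ord_recr /= scalerDl -XYv -linearZ -IH addrC.
by rewrite subrK.
Qed.

Lemma ladder_return j :
  iter j X (iter j Y v) = (\prod_(l < j) \sum_(i < l.+1) s i) *: v.
Proof.
elim: j => [|j IH]; first by rewrite big_ord0 scale1r.
rewrite iterSr ladder_step [in RHS]big_ord_recr /= mulrC -scalerA -IH.
move: (\sum_(i < _) _) (iter j Y v) => c; elim: (j) => // l IHl u.
by rewrite !iterSr linearZ IHl.
Qed.

(** Applying [X] another [J] times to [iter J Y v = 0] returns [v] times the product of the partial
    sums, so one factor vanishes. *)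
Lemma ladder_stop J : v != 0 -> iter J Y v = 0 -> exists j, \sum_(i < j.+1) s i = 0.
Proof.
move=> v0 Jv; have := ladder_return J; rewrite Jv.
have -> : iter J X 0 = 0 by elim: (J) => //= j ->; rewrite linear0.
move/esym/eqP; rewrite scaler_eq0 (negPf v0) orbF prodf_seq_eq0.
by case/hasP => j _ /eqP ?; exists j.
Qed.

End Ladder.

Lemma iter_last (K : fieldType) (V : lmodType K) (X : {linear V -> V}) v J :
  v != 0 -> iter J X v = 0 -> exists j, iter j X v != 0 /\ X (iter j X v) = 0.
Proof.
elim: J v => [|J IH] v v0; first by move=> /= E; rewrite E eqxx in v0.
rewrite iterSr; have [Xv _|Xv] := eqVneq (X v) 0; first by exists 0%N.
by case/(IH _ Xv) => j [? ?]; exists j.+1; rewrite !iterSr.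
Qed.

(** These are the ladder sums of sl_2, where the eigenvalue drops by 2 at each step; in
    characteristic zero a vanishing one forces [p = j]. *)
Lemma sum_arith (K : fieldType) (p : K) j :
  \sum_(i < j.+1) (p - 2%:R * i%:R) = j.+1%:R * (p - j%:R).
Proof.
elim: j => [|j IH]; first by rewrite big_ord1 mulr0 mul1r.
by rewrite big_ord_recr IH /= !mulrSr; ring.
Qed.

(** * The action of elements [X ⊗ a] and the weight shifts gam + n delta *)

Section LoopAction.
Variables (K : fieldType) (g : finLieAlgType K) (B : invariant_form g).
Variables (td : triangular_decomposition g) (A : comAlgType K).
Variables (V : lmodType K) (rho : lie_module (loop_affVir B A) V).
Implicit Types (X Y : affVir B) (a b : A) (v : V).

Definition tact a X v : V := rho (X ⊗ a) v.

Fact tact_is_linear a X : linear (tact a X).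
Proof. by move=> c u v; exact: (bilinPr (lact_bilin rho)). Qed.
HB.instance Definition _ a X := GRing.isLinear.Build K V V *:%R (tact a X)
  (tact_is_linear a X).

Lemma tactP a c X Y v : tact a (c *: X + Y) v = c *: tact a X v + tact a Y v.
Proof.
rewrite /tact -(bilinPl (lact_bilin rho)); congr (rho _ v).
exact: (bilinPl (@pure_tensor_bilin _ _ _)).
Qed.
Lemma tact0 a v : tact a 0 v = 0.
Proof.
have := tactP a 1 0 0 v; rewrite scaler0 addr0 scale1r => /eqP.
by rewrite addrC -subr_eq subrr eq_sym => /eqP.
Qed.
Lemma tactD a X Y v : tact a (X + Y) v = tact a X v + tact a Y v.
Proof. by have := tactP a 1 X Y v; rewrite !scale1r. Qed.
Lemma tactZ a c X v : tact a (c *: X) v = c *: tact a X v.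
Proof. by rewrite -[c *: X]addr0 tactP tact0 addr0. Qed.

Lemma tact_br a b X Y v :
  tact (a * b) (affVir_bracket X Y) v = tact a X (tact b Y v) - tact b Y (tact a X v).
Proof.
rewrite /tact -lact_bracket; congr (rho _ v).
by symmetry; exact: (@current_bracketE K (affVir B) A X Y a b).
Qed.

Lemma loop_eltZ n (c : K) x : loop_elt B (c *: x) n = c *: loop_elt B x n.
Proof.
apply: quad_eq; rewrite /= ?scaler0 //.
by apply: fscoefP => i; rewrite fsmodZ !fsmonoE; case: eqP; rewrite ?scaler0.
Qed.

Lemma loop_elt0 n : loop_elt B 0 n = 0.
Proof. by rewrite -(scale0r (0 : g)) loop_eltZ scale0r. Qed.

Local Notation dual := 'Hom(subvs_of (td_h td), K^o).
Local Notation weight := 'Hom(hbar td, K^o).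

Definition wt_shift_fun (gam : dual) (n : int) (u : hbar td) : K^o :=
  gam u.1.1.1 + n%:~R * u.1.2.
Fact wt_shift_is_linear gam n : linear (wt_shift_fun gam n).
Proof.
move=> c u v; rewrite /wt_shift_fun /=.
by rewrite linearP mulrDr scalerDr addrACA; congr (_ + (_ + _)); rewrite /GRing.scale /= mulrCA.
Qed.
HB.instance Definition _ gam n :=
  GRing.isLinear.Build K (hbar td) K^o *:%R (wt_shift_fun gam n)
    (wt_shift_is_linear gam n).

(* gam + n delta *)
Definition wt_shift gam n : weight := linfun (wt_shift_fun gam n).

Lemma wt_shiftE gam n u : wt_shift gam n u = gam u.1.1.1 + n%:~R * u.1.2.
Proof. by rewrite lfunE. Qed.

Lemma wt_shiftD gam gam' n n' :
  wt_shift gam n + wt_shift gam' n' = wt_shift (gam + gam') (n + n').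
Proof.
apply/lfunP => u; rewrite add_lfunE !wt_shiftE add_lfunE rmorphD /= mulrDl.
by rewrite addrACA.
Qed.
Lemma wt_shiftN gam n : - wt_shift gam n = wt_shift (- gam) (- n).
Proof.
by apply/lfunP => u; rewrite opp_lfunE !wt_shiftE opp_lfunE rmorphN /= mulNr opprD.
Qed.
Lemma wt_shift0 : wt_shift 0 0 = 0.
Proof. by apply/lfunP => u; rewrite !wt_shiftE !zero_lfunE mul0r addr0. Qed.

Definition hz (z : subvs_of (td_h td)) : hbar td := (z, 0, 0, 0).
Definition hK : hbar td := (0, 1, 0, 0).

Definition eigen_of X (chi : weight) : Prop :=
  forall u : hbar td, affVir_bracket (hbar_elt B u) X = (chi u : K) *: X.

Lemma hbar_bracket (u : hbar td) X : affVir_bracket (hbar_elt B u) X =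
  affVir_bracket (loop_elt B (vsval u.1.1.1) 0) X + (u.1.2 : K) *: affVir_bracket (vird B 0) X.
Proof.
rewrite /hbar_elt !(bilinDl (affVir_bilin B)) !(bilinZl (affVir_bilin B)).
by rewrite br_affKl br_virCl !scaler0 !addr0.
Qed.

Lemma eigen_loop gam x n : root_space gam x -> eigen_of (loop_elt B x n) (wt_shift gam n).
Proof.
move=> gx u; rewrite hbar_bracket br_loop_loop br_vird_loop gx !add0r loop_eltZ.
have -> : (if n == - 0 then n%:~R * B (vsval u.1.1.1) x else 0 : K) = 0.
  by rewrite oppr0; case: eqP => // ->; rewrite mul0r.
by rewrite scale0r addr0 scalerA -scalerDl wt_shiftE mulrC.
Qed.

Lemma eigen_vird n : eigen_of (vird B n) (wt_shift 0 n).
Proof.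
move=> u; rewrite hbar_bracket br_loop_vird br_vird_vird expr0n subrr mul0r if_same.
rewrite oppr0 !scale0r !add0r addr0 subr0 scalerA.
by rewrite wt_shiftE zero_lfunE add0r mulrC.
Qed.

Local Notation wsp := (@weight_space K g B td A V rho).

Lemma wsp_shift X chi a lam v : eigen_of X chi -> wsp lam v -> wsp (lam + chi) (tact a X v).
Proof.
move=> Xchi lv u; rewrite -/(tact 1 (hbar_elt B u) _) -/(tact 1 _ _).
have := tact_br 1 a (hbar_elt B u) X v; rewrite mul1r Xchi tactZ.
have -> : tact 1 (hbar_elt B u) v = (lam u : K) *: v by exact: lv.
move/eqP; rewrite eq_sym subr_eq => /eqP ->.
by rewrite linearZ -scalerDl add_lfunE addrC.
Qed.

Lemma wsp_hz lam z v : wsp lam v -> tact 1 (loop_elt B (vsval z) 0) v = (lam (hz z) : K) *: v.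
Proof.
move=> lv; rewrite -(lv (hz z)) /tact /hbar_elt /= !scale0r.
by rewrite -[_ + _ in RHS]/(loop_elt B (vsval z) 0 + 0 + 0 + 0) !addr0.
Qed.

Lemma wsp_K lam v : wsp lam v -> tact 1 (affK B) v = (lam hK : K) *: v.
Proof.
move=> lv; rewrite -(lv hK) /tact /hbar_elt /= !scale0r scale1r loop_elt0.
by rewrite add0r !addr0.
Qed.

Lemma lam_hz_shift (lam : weight) gam n z : (lam + wt_shift gam n) (hz z) = lam (hz z) + gam z.
Proof. by rewrite add_lfunE wt_shiftE /= mulr0 addr0. Qed.

Definition wt_fin_fun (mu : weight) z : K^o := mu (hz z).
Fact wt_fin_is_linear mu : linear (wt_fin_fun mu).
Proof.
move=> c u v; rewrite /wt_fin_fun -linearP; congr (mu _).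
by congr (_, _, _, _); rewrite /= ?scaler0 ?addr0.
Qed.
HB.instance Definition _ mu := GRing.isLinear.Build K (subvs_of (td_h td)) K^o *:%R
  (wt_fin_fun mu) (wt_fin_is_linear mu).

Definition wt_fin mu : dual := linfun (wt_fin_fun mu).

Lemma wt_finE mu z : wt_fin mu z = mu (hz z).
Proof. by rewrite lfunE. Qed.

Lemma wt_fin_shift mu gam n : wt_fin (mu + wt_shift gam n) = wt_fin mu + gam.
Proof. by apply/lfunP => u; rewrite add_lfunE !wt_finE lam_hz_shift. Qed.

Definition is_wt lam := exists v, v != 0 /\ wsp lam v.

End LoopAction.

(** * Eigenbases for the Cartan subalgebra, root vectors and the trace form *)

Lemma spanning_set_basis (K : fieldType) (W : vectType K) (E : set W) :
  (forall x, lin_span E x) ->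
  exists X : seq W, basis_of fullv X /\ forall x, x \in X -> E x.
Proof.
move=> Espan.
(* Free families drawn from [E] grow by one vector until they span; at this [k] the other
   alternative would be a free family longer than the dimension. *)
suff /(_ (\dim {:W}).+1) [X [fX EX [Xfull|]]] : forall k, exists X : seq W,
    [/\ free X, (forall x, x \in X -> E x) & (<<X>>%VS = fullv \/ k <= size X)%N].
- by exists X; split=> //; rewrite /basis_of Xfull eqxx.
- move=> kX; move: fX; rewrite /free => /eqP dX.
  by have := dimvS (subvf <<X>>%VS); rewrite dX leqNgt kX.
elim=> [|k [X [fX EX [Xfull|kX]]]].
- by exists [::]; split=> //; [exact: nil_free|right].
- by exists X; split=> //; left.
have [Xfull|XN] := pselect (<<X>>%VS = fullv); first by exists X; split=> //; left.
have [e [Ee eX]] : exists e, E e /\ e \notin <<X>>%VS.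
  apply: contra_notP XN => nE; apply/eqP; rewrite eqEsubv subvf; apply/subvP => x _.
  elim/lin_span_ind: (Espan x) => [|a u v Eu vX]; first exact: mem0v.
  apply: memvD => //; apply: memvZ; apply/negPn/negP => uX; apply: nE.
  by exists u.
exists (e :: X); split; [by rewrite free_cons eX| |by right].
by move=> x; rewrite inE => /predU1P[->|/EX].
Qed.

Section RootVectors.
Variables (K : fieldType) (g : finLieAlgType K) (B : invariant_form g).
Variables (td : triangular_decomposition g).
Local Notation h := (td_h td).
Local Notation dual := 'Hom(subvs_of h, K^o).
Local Notation lb := (@lie_bilinear K g).

Lemma td_span (x : g) : lin_span [set y | y \in h \/
  exists alpha, is_root alpha /\ root_space (alpha : dual) y] x.
Proof.
have : x \in (td_nneg td + h + td_npos td)%VS by rewrite td_sum memvf.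
case/memv_addP => y /memv_addP[u uN [w wh ->]] [z zP ->].
have sub (S S' : set g) t : S `<=` S' -> lin_span S t -> lin_span S' t.
  by move=> SS' [n [c [s [Ss ->]]]]; exists n, c, s; split=> // i; exact/SS'.
apply: lin_spanD; first apply: lin_spanD.
- by apply: sub ((td_nnegP td u).1 uN) => t [al [[? _] ?]]; right; exists al.
- by apply: sub_lin_span; left.
- by apply: sub ((td_nposP td z).1 zP) => t [al [[? _] ?]]; right; exists al.
Qed.

Lemma root_eigenbasis : exists n (X : n.-tuple g) (bet : 'I_n -> dual),
  basis_of fullv X /\ forall i, root_space (bet i) X`_i /\
    ((bet i = 0 /\ X`_i \in h) \/ is_root (bet i)).
Proof.
have [X [bX EX]] := spanning_set_basis td_span.
have /choice[bet betP] : forall i : 'I_(size X), exists b : dual,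
    root_space b X`_i /\ ((b = 0 /\ X`_i \in h) \/ is_root b).
  move=> i; case: (EX X`_i (mem_nth _ (ltn_ord i))) => [Xh|[al [al_root alX]]].
    exists 0; split; last by left.
    by move=> u; rewrite zero_lfunE scale0r (td_abelian (subvsP u) Xh).
  by exists al; split=> //; right.
by exists (size X), (in_tuple X), bet.
Qed.

Variables (n : nat) (X : n.-tuple g) (bet : 'I_n -> dual).
Hypothesis bX : basis_of fullv X.
Hypothesis betX : forall i, root_space (bet i) X`_i.
Hypothesis bet0 : forall i, (bet i = 0 /\ X`_i \in h) \/ is_root (bet i).

(** Compare the [i]-th coordinates of both sides of the eigenvector equation for [x]. *)
Lemma root_space_coord (gam : dual) x i : root_space gam x -> coord X i x != 0 -> bet i = gam.
Proof.
move=> gx xi; apply/lfunP => u; apply/eqP; rewrite -subr_eq0 -(mulIr_eq0 _ (mulIf xi)).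
rewrite mulrBl subr_eq0; apply/eqP.
have := gx u; rewrite [in LHS](coord_basis bX (memvf x)) => /(congr1 (coord X i)).
rewrite linearZ /= => <-.
have -> : [lie vsval u, \sum_(j < n) coord X j x *: X`_j]
    = \sum_(j < n) (coord X j x * bet j u) *: X`_j.
  elim/big_rec2: _ => [|j y y' _ IH]; first exact: (bilin0r lb).
  by rewrite (bilinPr lb) betX scalerA addrC IH addrC.
by rewrite coord_sum_free ?(basis_free bX) // mulrC.
Qed.

Lemma root_index (alpha : dual) : is_root alpha -> exists i, bet i = alpha.
Proof.
case=> _ [x [x0 ax]].
have [i xi] : exists i, coord X i x != 0.
  apply: contra_notP (negP x0) => nex; apply/eqP.
  rewrite (coord_basis bX (memvf x)) big1 // => i _.
  case: (eqVneq (coord X i x) 0) => [->|xi]; first by rewrite scale0r.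
  by case: nex; exists i.
by exists i; exact: root_space_coord xi.
Qed.

(** A basis vector occurring in [x] has eigenvalue 0, which is not a root, so it lies in [h]. *)
Lemma root_space0 x : root_space (0 : dual) x -> x \in h.
Proof.
move=> gx; rewrite (coord_basis bX (memvf x)); apply: memv_suml => i _.
case: (eqVneq (coord X i x) 0) => [->|xi]; first by rewrite scale0r mem0v.
apply: memvZ; case: (bet0 i) => [[_ //]|[]].
by rewrite (root_space_coord gx xi) eqxx.
Qed.

Lemma root_space_bracket (al be : dual) x y :
  root_space al x -> root_space be y -> root_space (al + be) [lie x, y].
Proof.
move=> ax bY u; have := lie_jacobi (vsval u) x y.
rewrite [[lie y, _]]lie_anti bY ax (bilinNr lb) (bilinZr lb) add_lfunE.
rewrite [[lie y, _]]lie_anti (bilinZl lb) => /eqP.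
by rewrite -addrA -opprD subr_eq0 => /eqP ->; rewrite addrC -scalerDl.
Qed.

Lemma iform_root_space (al be : dual) x y :
  root_space al x -> root_space be y -> al + be != 0 -> B x y = 0.
Proof.
move=> ax bY; apply: contraNeq => Bxy; apply/eqP/lfunP => u.
have := iform_inv B (x) (vsval u) y.
rewrite [[lie x, _]]lie_anti ax bY (bilinNl (iform_bilin B)) (bilinZl (iform_bilin B)).
rewrite (bilinZr (iform_bilin B)) => /eqP; rewrite eq_sym -addr_eq0 -scalerDl.
by rewrite scaler_eq0 (negPf Bxy) orbF add_lfunE zero_lfunE addrC => /eqP.
Qed.

(** Nondegeneracy gives a basis vector pairing nontrivially with [e]; orthogonality of root spaces
    forces its eigenvalue to be [- al]. *)
Lemma opp_root_vector (al : dual) e : root_space al e -> e != 0 ->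
  exists f, root_space (- al) f /\ B e f != 0.
Proof.
move=> ae e0.
have [i ei] : exists i : 'I_n, B e X`_i != 0.
  apply: contra_notP (negP e0) => nex; apply/eqP; apply: (iform_nondeg (i := B)) => y.
  rewrite (coord_basis bX (memvf y)).
  elim/big_rec: _ => [|i w _ IH]; first exact: (bilin0r (iform_bilin B)).
  rewrite (bilinPr (iform_bilin B)) IH addr0.
  case: (eqVneq (B e X`_i) 0) => [->|ei]; first by rewrite scaler0.
  by case: nex; exists i.
exists X`_i; split=> //.
suff <- : bet i = - al by [].
apply/eqP; rewrite -addr_eq0 addrC; apply/eqP.
apply: contraNeq ei => nz; apply/eqP; exact: (iform_root_space ae (betX i)).
Qed.

(* Evaluating the trace of [h, e] f in an eigenbasis, where the i-th diagonal
   entry of [h, e] f is weighted by the eigenvalues of h at both ends. *)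
Lemma trace_form_coroot (al : dual) e f (z : subvs_of h) :
  root_space al e -> vsval z = [lie e, f] ->
  exists c : K, forall u, \sum_i (bet i u : K) * (bet i z : K) = (al u : K) * c.
Proof.
move=> ae zE.
pose E (i j : 'I_n) : K := coord X j [lie e, X`_i].
pose F (i j : 'I_n) : K := coord X j [lie f, X`_i].
have brE y (G : 'I_n -> 'I_n -> K) (i : 'I_n) : (forall i j, G i j = coord X j [lie y, X`_i]) ->
    [lie y, X`_i] = \sum_j G i j *: X`_j.
  by move=> GE; rewrite [LHS](coord_basis bX (memvf _)); apply: eq_bigr => j _; rewrite GE.
have brS y (c : 'I_n -> K) : [lie y, \sum_j c j *: X`_j] = \sum_j c j *: [lie y, X`_j].
  elim/big_rec2: _ => [|j w w' _ IH]; first exact: (bilin0r lb).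
  by rewrite (bilinPr lb) IH.
have zX (i : 'I_n) : bet i z = \sum_j (F i j * E j i - E i j * F j i) :> K.
  have := betX i z; rewrite zE.
  have -> : [lie [lie e, f], X`_i] = [lie e, [lie f, X`_i]] - [lie f, [lie e, X`_i]].
    have := lie_jacobi e f X`_i; rewrite [[lie X`_i, [lie _, _]]]lie_anti.
    rewrite [[lie X`_i, _]]lie_anti (bilinNr lb) => /eqP.
    by rewrite subr_eq0 => /eqP.
  rewrite (brE f F) // (brE e E) // !brS => /(congr1 (coord X i)).
  rewrite linearB !linear_sum linearZ /= coord_free ?(basis_free bX) // eqxx mulr1 => <-.
  by rewrite -sumrB; apply: eq_bigr => j _; rewrite !linearZ.
exists (\sum_i \sum_j E i j * F j i) => u.
(* [ad e] has an entry from [X_i] to [X_j] only if [bet j = bet i + al]. Once the indices are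
   exchanged in half of the double sum, this leaves the common factor [al u]. *)
have EB i j : E i j * (bet j u - bet i u - al u) = 0 :> K.
  apply/eqP; rewrite mulf_eq0; apply/orP; case: (eqVneq (E i j) 0) => [|Eij]; [by left|right].
  have := root_space_bracket ae (betX i) => /root_space_coord/(_ Eij) ->.
  by rewrite add_lfunE; apply/eqP; ring.
transitivity (\sum_i \sum_j (bet i u * F i j * E j i - bet i u * E i j * F j i : K)).
  apply: eq_bigr => i _; rewrite zX mulr_sumr; apply: eq_bigr => j _.
  by rewrite mulrBr !mulrA.
under eq_bigr do rewrite sumrB; rewrite sumrB exchange_big /= -sumrB mulr_sumr.
apply: eq_bigr => i _; rewrite -sumrB mulr_sumr; apply: eq_bigr => j _.
apply/eqP; rewrite -subr_eq0; apply/eqP.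
transitivity (E i j * (bet j u - bet i u - al u) * F j i : K); first by ring.
by rewrite EB mul0r.
Qed.

End RootVectors.

(** * Weight strings in the directions al + n delta at level [k] *)

Section WeightStrings.
Variables (K : numFieldType) (g : finLieAlgType K) (B : invariant_form g).
Variables (td : triangular_decomposition g) (A : comAlgType K).
Variables (V : lmodType K) (rho : lie_module (loop_affVir B A) V).
Hypothesis V_int : integrable td rho.
Variable k : K.
Hypothesis (Kk : forall v, tact rho 1 (affK B) v = k *: v).
Local Notation h := (td_h td).
Local Notation dual := 'Hom(subvs_of h, K^o).
Local Notation weight := 'Hom(hbar td, K^o).
Local Notation wsp := (@weight_space K g B td A V rho).
Local Notation is_wt := (@is_wt K g B td A V rho).
Local Notation loop x n := (tact rho 1 (loop_elt B x n)).
Implicit Types (al : dual) (mu : weight) (z : subvs_of h).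

Lemma lfun_mulrn al j z : (al *+ j) z = (al z : K) *+ j.
Proof. by elim: j => [|j IH]; rewrite ?mulr0n ?zero_lfunE // !mulrS add_lfunE IH. Qed.

Lemma hzN mu z : mu (hz (- z)) = - mu (hz z).
Proof.
have -> : hz (- z) = - hz z :> hbar td.
  by congr (_, _, _, _); symmetry; exact: oppr0.
by rewrite linearN.
Qed.

Lemma wsp_iter al x n j mu v : root_space al x -> wsp mu v ->
  wsp (mu + wt_shift (al *+ j) (n * j%:Z)) (iter j (loop x n) v).
Proof.
move=> ax muv; elim: j => [|j IH]; first by rewrite mulr0n mulr0 wt_shift0 addr0.
rewrite mulrSr -addn1 PoszD mulrDr mulr1 -wt_shiftD addrA addn1 iterS.
by apply: wsp_shift IH; apply: eigen_loop.
Qed.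

Lemma loop_comm e f z n mu v : vsval z = [lie e, f] -> wsp mu v ->
  loop e n (loop f (- n) v) - loop f (- n) (loop e n v)
  = ((mu (hz z) : K) - n%:~R * (B e f * k)) *: v.
Proof.
move=> zE muv; rewrite -tact_br mul1r br_loop_loop subrr eqxx tactD tactZ -zE.
rewrite (wsp_hz _ muv) Kk scalerA -scalerDl; congr (_ *: _).
by rewrite rmorphN /=; congr (_ + _); ring.
Qed.

(** The ladder hypothesis for e t^n and f t^-n: each f t^-n lowers the value at [z] by [al z], while
    the central term stays constant. *)
Lemma loop_string al e f z n mu v : root_space (- al) f ->
  vsval z = [lie e, f] -> wsp mu v -> loop e n v = 0 -> forall j,
  let w := iter j (loop f (- n)) v in
  loop e n (loop f (- n) w) - loop f (- n) (loop e n w)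
  = (((mu (hz z) : K) - n%:~R * (B e f * k)) - (al z : K) * j%:R) *: w.
Proof.
move=> af zE muv ev j w.
rewrite (loop_comm n zE (wsp_iter (- n) j af muv)) lam_hz_shift lfun_mulrn opp_lfunE.
by congr (_ *: _); rewrite mulNrn -mulr_natr; ring.
Qed.

Lemma loop_nilp al x n : is_root al -> root_space al x -> forall v,
  exists J, iter J (loop x n) v = 0.
Proof. by case: V_int => _ _ nilp ar ax; exact: (nilp al x n 1 ar ax). Qed.

Lemma is_root_opp al e f : is_root al -> root_space (- al) f -> B e f != 0 -> is_root (- al).
Proof.
move=> [al0 _] af Bef; split; first by rewrite oppr_eq0.
exists f; split=> //; apply: contraNneq Bef => ->.
by rewrite (bilin0r (iform_bilin B)).
Qed.

Lemma loop_last al e n mu : is_root al -> root_space al e -> is_wt mu ->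
  exists j v, [/\ v != 0, wsp (mu + wt_shift (al *+ j) (n * j%:Z)) v & loop e n v = 0].
Proof.
move=> ar ae [v [v0 muv]]; have [J Jv] := loop_nilp n ar ae v.
have [j [ve Xve]] := iter_last v0 Jv.
by exists j, (iter j (loop e n) v); split=> //; exact: wsp_iter.
Qed.

(* If al z were 0 then e t^n and f t^-n would span, for suitable n, a
   Heisenberg algebra acting locally nilpotently. *)
Lemma root_coroot_neq0 al e f z mu : k != 0 -> is_root al -> root_space al e ->
  root_space (- al) f -> B e f != 0 -> vsval z = [lie e, f] -> is_wt mu -> al z != 0.
Proof.
move=> k0 ar ae af Bef zE muP; apply/negP => /eqP az.
(* The central value is affine in [n] with nonzero slope, so [n = 0] or [n = 1] avoids its zero. *)
have [n pn] : exists n : int, (mu (hz z) : K) - n%:~R * (B e f * k) != 0.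
  case: (eqVneq (mu (hz z) : K) 0) => [->|mz]; last by exists 0; rewrite mul0r subr0.
  by exists 1; rewrite mul1r sub0r oppr_eq0 mulf_neq0.
have [j [v [v0 nuv ev]]] := loop_last n ar ae muP.
have [J fJ] := loop_nilp (- n) (is_root_opp ar af Bef) af v.
have [l] := ladder_stop ev (loop_string af zE nuv ev) v0 fJ.
apply/eqP; under eq_bigr do rewrite az mul0r subr0.
rewrite lam_hz_shift lfun_mulrn az mul0rn addr0 sumr_const card_ord -mulr_natr.
by rewrite mulf_neq0 // pnatr_eq0.
Qed.

(* z is the coroot of al, and z - n m is the coroot of al + n delta acting
   on modules of level k *)
Definition coroot_datum al z (m : int) : Prop :=
  [/\ is_root al, (al z : K) = 2%:R, m != 0 &
   exists e f, [/\ root_space al e, root_space (- al) f, vsval z = [lie e, f]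
     & B e f * k = m%:~R]].

(** Exchanging [e] and [f] negates [z] but keeps [B e f], hence [m]. *)
Lemma datum_opp al z m : coroot_datum al z m -> coroot_datum (- al) (- z) m.
Proof.
move=> [ar az m0 [e [f [ae af zE Bm]]]]; split=> //.
- apply: (is_root_opp ar af (e := e)); apply: contraNneq m0 => Bef.
  by move/esym/eqP: Bm; rewrite Bef mul0r intr_eq0.
- by rewrite opp_lfunE linearN opprK.
exists f, e; split=> //; first by rewrite opprK.
  by rewrite lie_anti -zE linearN.
by rewrite iform_sym.
Qed.

(** At the top of the e t^n string through [mu], [j] steps up, the ladder makes the coroot value a
    natural number [l]; at [mu] it is therefore [l - 2j]. *)
Lemma coroot_value_int al e f z mu n : is_root al -> root_space al e ->
  root_space (- al) f -> B e f != 0 -> vsval z = [lie e, f] -> (al z : K) = 2%:R ->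
  is_wt mu -> exists p : int, (mu (hz z) : K) - n%:~R * (B e f * k) = p%:~R.
Proof.
move=> ar ae af Bef zE az muP.
have [j [v [v0 nuv ev]]] := loop_last n ar ae muP.
have [J fJ] := loop_nilp (- n) (is_root_opp ar af Bef) af v.
have [l] := ladder_stop ev (loop_string af zE nuv ev) v0 fJ.
rewrite az sum_arith => /eqP; rewrite mulf_eq0 pnatr_eq0 /= subr_eq0 => /eqP.
rewrite lam_hz_shift lfun_mulrn az => lE; exists (l%:Z - 2 * j%:Z).
rewrite rmorphB rmorphM /= -!pmulrn -lE -mulr_natr; ring.
Qed.

Lemma datum_int al z m mu : coroot_datum al z m -> is_wt mu ->
  exists p : int, (mu (hz z) : K) = p%:~R.
Proof.
move=> [ar az m0 [e [f [ae af zE Bm]]]] muP.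
have Bef : B e f != 0.
  by apply: contraNneq m0 => Bef; move/esym/eqP: Bm; rewrite Bef mul0r intr_eq0.
have [p] := coroot_value_int 0 ar ae af Bef zE az muP.
by rewrite mul0r subr0; exists p.
Qed.

(** If f t^-n killed a vector of weight [mu], the ladder of e t^n starting there would force
    [- (p - n * m)] to be a natural number. *)
Lemma datum_move al z m mu (p n : int) : coroot_datum al z m -> is_wt mu ->
  (mu (hz z) : K) = p%:~R -> 0 < p - n * m -> is_wt (mu - wt_shift al n).
Proof.
move=> dm [v [v0 muv]] mup pos.
have [ar az m0 [e [f [ae af zE Bm]]]] := dm.
have [nr naz _ _] := datum_opp dm.
exists (loop f (- n) v); split; last first.
  by rewrite wt_shiftN; apply: wsp_shift muv; exact: eigen_loop.
apply/negP => /eqP fv; have [J eJ] := loop_nilp n ar ae v.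
have nzE : vsval (- z) = [lie f, e] by rewrite lie_anti -zE linearN.
(* [loop_string] is used with [e] and [f] exchanged, hence with [- al] and [- n]. *)
rewrite -[al]opprK in ae; rewrite -[n]opprK in eJ.
have [l] := ladder_stop fv (loop_string ae nzE muv fv) v0 eJ.
have -> : (mu (hz (- z)) : K) = - p%:~R by rewrite hzN mup.
rewrite naz sum_arith iform_sym Bm => /eqP; rewrite mulf_eq0 pnatr_eq0 /= => /eqP E.
have : ((- p + n * m - l%:Z)%:~R : K) == 0.
  by rewrite -E; apply/eqP; rewrite !(rmorphB, rmorphD, rmorphN, rmorphM) /=; ring.
by rewrite intr_eq0 => /eqP; lia.
Qed.

(** [f] is rescaled so that [al] takes the value 2 at the coroot. The values of [mu0] at the coroots
    of al and al + delta are integers, and their difference is [m]. *)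
Lemma root_datum al mu0 : k != 0 -> is_wt mu0 -> is_root al -> exists z m, coroot_datum al z m.
Proof.
move=> k0 mu0P ar; have [n [X [bet [bX betX]]]] := root_eigenbasis td.
have betX1 i := (betX i).1; have betX2 i := (betX i).2.
have [al0 [e [e0 ae]]] := ar.
have [f [af Bef]] := opp_root_vector B bX betX1 ae e0.
have efh : [lie e, f] \in h.
  by apply: (root_space0 bX betX1 betX2); rewrite -(subrr al); exact: root_space_bracket.
pose z := Subvs efh; have zE : vsval z = [lie e, f] by [].
have az := root_coroot_neq0 k0 ar ae af Bef zE mu0P.
pose c : K := 2%:R / (al z : K); have c0 : c != 0 by rewrite mulf_neq0 ?invr_eq0 ?pnatr_eq0.
pose z' := c *: z; pose f' := c *: f.
have af' : root_space (- al) f'.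
  by move=> u; rewrite (bilinZr (@lie_bilinear _ _)) af !scalerA mulrC.
have zE' : vsval z' = [lie e, f'] by rewrite linearZ /= (bilinZr (@lie_bilinear _ _)).
have az' : (al z' : K) = 2%:R by rewrite linearZ; exact: divfK.
have Bef' : B e f' != 0 by rewrite (bilinZr (iform_bilin B)) mulf_neq0.
have [p0 E0] := coroot_value_int 0 ar ae af' Bef' zE' az' mu0P.
have [p1 E1] := coroot_value_int 1 ar ae af' Bef' zE' az' mu0P.
have Bm : B e f' * k = (p0 - p1)%:~R by rewrite rmorphB /= -E0 -E1; ring.
exists z', (p0 - p1); split=> //; last by exists e, f'.
by apply: contraNneq (mulf_neq0 Bef' k0) => m0; rewrite Bm m0.
Qed.

Lemma nilp_uniform (X : {linear V -> V}) (W : set V) : fin_dim W ->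
  (forall v, exists J, iter J X v = 0) -> exists J, forall v, W v -> iter J X v = 0.
Proof.
move=> [s Ws] nilp.
have iterP j a u v : iter j X (a *: u + v) = a *: iter j X u + iter j X v.
  by elim: j => //= j ->; rewrite linearP.
have iter0 j : iter j X 0 = 0 by elim: j => //= j ->; rewrite linear0.
have [J JP] : exists J, forall u, u \in s -> iter J X u = 0.
  elim: (s) => [|u t [J JP]]; first by exists 0%N.
  have [J' J'u] := nilp u; exists (J + J')%N => w; rewrite inE => /predU1P[->|wt].
    by rewrite iterD J'u iter0.
  by rewrite addnC iterD (JP _ wt) iter0.
exists J => v /Ws; elim/lin_span_ind => [|a x y xs IH]; first exact: iter0.
by rewrite iterP IH (JP x xs) scaler0 addr0.
Qed.

(* V_(mu + j beta) embeds into V_mu by f^j, and the nilpotent e does not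
   vanish on the image. *)
Lemma string_bounded al z m mu (p n : int) : coroot_datum al z m -> is_wt mu ->
  (mu (hz z) : K) = p%:~R -> 0 <= p - n * m ->
  exists J : nat, ~ is_wt (mu + wt_shift (al *+ J.+1) (n * J.+1%:Z)).
Proof.
move=> dm muP mup pos; have [ar az m0 [e [f [ae af zE Bm]]]] := dm.
have [_ fd _] := V_int.
have [J JP] := nilp_uniform (fd mu) (loop_nilp n ar ae).
(* The ladder needs a vector killed by e t^n, so the given one is first raised [i] further steps;
   the total height still exceeds [J]. *)
exists J => nuP; have [i [v [v0 vnu ev]]] := loop_last n ar ae nuP.
set j := (J.+1 + i)%N.
have {}vnu : wsp (mu + wt_shift (al *+ j) (n * j%:Z)) v.
  by move: vnu; rewrite -addrA wt_shiftD -mulrnDr -mulrDr.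
have := ladder_return ev (loop_string af zE vnu ev) j.
have fjv : wsp mu (iter j (loop f (- n)) v).
  have := wsp_iter (- n) j af vnu.
  by rewrite -addrA wt_shiftD mulNrn subrr mulNr subrr wt_shift0 addr0.
have -> w : wsp mu w -> iter j (loop e n) w = 0 ; last exact: fjv.
  move=> muw; rewrite /j addSnnS addnC iterD (JP _ muw).
  by elim: (i.+1) => //= l ->; rewrite linear0.
(* A vanishing factor means [p - n * m + 2 * j = l] with [l < j], impossible as [p - n * m] is
   nonnegative. *)
move/esym/eqP; rewrite scaler_eq0 (negPf v0) orbF prodf_seq_eq0 => /hasP[l _ /=].
rewrite az sum_arith mulf_eq0 pnatr_eq0 /= Bm lam_hz_shift lfun_mulrn az mup => /eqP E.
have : ((p - n * m + 2 * j%:Z - l%:Z)%:~R : K) == 0.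
  rewrite -E -mulr_natr; apply/eqP.
  by rewrite !(rmorphB, rmorphD, rmorphN, rmorphM) /=; ring.
by rewrite intr_eq0 => /eqP; have := ltn_ord l; lia.
Qed.

(* Otherwise mu + N eps delta, for N large, would lead by strings in the
   directions al - b eps delta to mu + J (al + a eps delta). *)
Lemma delta_bounded al z m mu (eps : int) : coroot_datum al z m -> is_wt mu ->
  0 < - eps * m -> exists N0 : int, forall N, N0 <= N -> ~ is_wt (mu + wt_shift 0 (eps * N)).
Proof.
move=> dm muP M0; have [p mup] := datum_int dm muP.
set M := - eps * m in M0.
(* This makes [mu] nonnegative at the coroot of al + a eps delta. *)
pose a : int := `|p|.
have [|J Jwt] := @string_bounded al z m mu p (eps * a) dm muP mup.
  have -> : p - eps * a * m = p + a * M by rewrite /M; ring.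
  have : a <= a * M by apply: ler_peMr; rewrite /a //; lia.
  by rewrite {1}/a; lia.
(* With [b >= b0], the value at the coroot of -al + b eps delta stays positive after up to [J]
   additions of [al]. *)
pose b0 : int := `|p| + 2 * J%:Z + 1.
exists (J.+1%:Z * b0 + J.+1%:Z * a) => N N_ge NP.
have az : (al z : K) = 2%:R by case: dm.
have naz : (al (- z) : K) = - 2%:R by rewrite linearN /= az.
have mz : (mu (hz (- z)) : K) = - p%:~R by rewrite hzN mup.
have step (i : nat) (c b : int) : (i <= J)%N -> b0 <= b ->
    is_wt (mu + wt_shift (al *+ i) (eps * c)) ->
    is_wt (mu + wt_shift (al *+ i.+1) (eps * (c - b))).
  move=> iJ bb wi.
  have := datum_move (p := - p - 2 * i%:Z) (n := eps * b) (datum_opp dm) wi.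
  have -> : mu + wt_shift (al *+ i) (eps * c) - wt_shift (- al) (eps * b)
      = mu + wt_shift (al *+ i.+1) (eps * (c - b)).
    by rewrite -addrA wt_shiftN wt_shiftD opprK -mulrSr -mulrBr.
  rewrite lam_hz_shift lfun_mulrn naz mz; apply.
    by rewrite !(rmorphB, rmorphD, rmorphN, rmorphM) /= -mulr_natr; ring.
  have -> : - p - 2 * i%:Z - eps * b * m = - p - 2 * i%:Z + b * M by rewrite /M; ring.
  have : b <= b * M by apply: ler_peMr; lia.
  by rewrite /b0 in bb; lia.
have path i : (i <= J)%N -> is_wt (mu + wt_shift (al *+ i) (eps * (N - i%:Z * b0))).
  elim: i => [_|i IH iJ]; first by rewrite mulr0n mul0r subr0.
  have := step i _ b0 (ltnW iJ) (lexx _) (IH (ltnW iJ)).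
  by have -> : N - i%:Z * b0 - b0 = N - i.+1%:Z * b0 by rewrite -addn1 PoszD; ring.
(* The last step absorbs all the remaining delta coefficient, which is at least [b0] by the bound on
   [N]. *)
apply: Jwt; have := step J _ (N - J%:Z * b0 - J.+1%:Z * a) (leqnn J) _ (path J (leqnn J)).
have -> : eps * (N - J%:Z * b0 - (N - J%:Z * b0 - J.+1%:Z * a)) = eps * a * J.+1%:Z by ring.
apply; lia.
Qed.

End WeightStrings.

(** * The sign of the level and integrality of roots on coroots *)

Section ExtremalWeight.
Variables (K : numFieldType) (g : finLieAlgType K) (B : invariant_form g).
Variables (td : triangular_decomposition g) (A : comAlgType K).
Variables (V : lmodType K) (rho : lie_module (loop_affVir B A) V).
Hypothesis V_int : integrable td rho.
Variable k : K.
Hypothesis (Kk : forall v, tact rho 1 (affK B) v = k *: v).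
Local Notation h := (td_h td).
Local Notation dual := 'Hom(subvs_of h, K^o).
Local Notation weight := 'Hom(hbar td, K^o).
Local Notation is_wt := (@is_wt K g B td A V rho).
Local Notation coroot_datum := (@coroot_datum K g B td k).
Variable mu0 : weight.
Hypothesis mu0P : is_wt mu0.
Implicit Types (al : dual) (mu : weight) (z u w : subvs_of h).

(** A datum whose [m] had the opposite sign would allow a move by [- al] and then back by [al], each
    adding a large multiple of eps delta, against [delta_bounded]. *)
Lemma level_sign al0 : k != 0 -> is_root al0 -> exists eps : int, (eps = 1 \/ eps = -1) /\
  forall al z m, coroot_datum al z m -> 0 < - eps * m.
Proof.
move=> k0 /(root_datum V_int Kk k0 mu0P)[z0 [m0 dm0]].
have m00 : m0 != 0 by case: dm0.
pose eps : int := - sgz m0.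
have eps1 : eps = 1 \/ eps = -1 by rewrite /eps; case: sgzP m00 => //; [right|left].
have e0 : 0 < - eps * m0 by rewrite opprK mulrC; case: sgzP m00; lia.
have [N0 N0P] := delta_bounded V_int Kk dm0 mu0P e0.
exists eps; split=> // al z m dm; clearbody eps; rewrite mulNr.
apply/negPn/negP => le0.
have m_neq0 : m != 0 by case: dm.
have em : 0 < eps * m by case: eps1 => E; move: le0; rewrite E; lia.
have [p mup] := datum_int V_int Kk dm mu0P.
have b_pos (b : int) : 0 <= b -> b <= b * (eps * m) by move=> b0; apply: ler_peMr; lia.
(* [b] and [b'] make the two coroot values positive; [N0] enters [b'] so that [b + b'] passes the
   bound. *)
pose b : int := `|p| + 1; pose b' : int := `|p| + 3 + `|N0|.
have w1 := datum_move (n := - (eps * b)) V_int Kk dm mu0P mup.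
have {w1} : is_wt (mu0 - wt_shift al (- (eps * b))).
  apply: w1; have := b_pos b; rewrite mulNr opprK -mulrA mulrCA /b; lia.
move/(datum_move (n := - (eps * b')) (p := - (p - 2)) V_int Kk (datum_opp dm)) => w2.
apply: (N0P (b + b')); first by rewrite /b /b'; lia.
have -> : mu0 + wt_shift 0 (eps * (b + b')) =
    mu0 - wt_shift al (- (eps * b)) - wt_shift (- al) (- (eps * b')).
  by rewrite !wt_shiftN -[RHS]addrA wt_shiftD !opprK addNr; congr (_ + wt_shift _ _); ring.
apply: w2.
  have az : (al z : K) = 2%:R by case: dm.
  by rewrite wt_shiftN lam_hz_shift hzN mup opp_lfunE linearN /= az !rmorphN rmorphB /=; ring.
have := b_pos b'; rewrite mulNr opprK -mulrA mulrCA /b'; lia.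
Qed.

(** Two weights of [V] differing by [be] up to a multiple of delta both take integer values at
    [z]. *)
Lemma root_integrality al be z m : k != 0 -> coroot_datum al z m -> is_root be ->
  exists q : int, (be z : K) = q%:~R.
Proof.
move=> k0 dm /(root_datum V_int Kk k0 mu0P)[zb [mb dmb]].
have [p mup] := datum_int V_int Kk dmb mu0P.
have mb0 : mb != 0 by case: dmb.
(* This multiple of delta contributes a positive multiple of [mb ^+ 2], large enough to outweigh
   [p]. *)
have pos : 0 < p - (- (`|p| + 1) * mb) * mb.
  have : 0 < mb ^+ 2 by rewrite exprn_even_gt0.
  by rewrite expr2; nia.
have := datum_move V_int Kk dmb mu0P mup pos; rewrite wt_shiftN => w1.
have [p1 E1] := datum_int V_int Kk dm mu0P; have [p2 E2] := datum_int V_int Kk dm w1.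
exists (p1 - p2); rewrite rmorphB /= -E1 -E2 lam_hz_shift opp_lfunE.
by ring.
Qed.

(** * The trace form on the Cartan subalgebra *)

Section Eigenbasis.
Hypothesis k_neq0 : k != 0.
Variables (n : nat) (X : n.-tuple g) (bet : 'I_n -> dual).
Hypothesis bX : basis_of fullv X.
Hypothesis betX : forall i, root_space (bet i) X`_i.
Hypothesis bet0 : forall i, (bet i = 0 /\ X`_i \in h) \/ is_root (bet i).

(* the trace form of g restricted to h, computed in the eigenbasis *)
Definition trace_form u w : K := \sum_i (bet i u : K) * (bet i w : K).

Lemma trace_formC u w : trace_form u w = trace_form w u.
Proof. by apply: eq_bigr => i _; rewrite mulrC. Qed.

Lemma trace_formZr c u w : trace_form u (c *: w) = c * trace_form u w.
Proof. by rewrite mulr_sumr; apply: eq_bigr => i _; rewrite linearZ mulrCA. Qed.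

(** The form against [z] is [al] times a constant; evaluating at [z], where [al] is 2, identifies
    the constant through a sum of squares of integers, one of which is 4. *)
Lemma trace_form_coroot_datum al z m : coroot_datum al z m -> exists2 d : nat,
  (0 < d)%N & forall u, 2%:R * trace_form u z = d%:R * (al u : K).
Proof.
move=> dm; have [ar az _ [e [f [ae _ zE _]]]] := dm.
have [c cE] := trace_form_coroot bX betX ae zE.
have /choice[q qE] : forall i, exists q : int, (bet i z : K) = q%:~R.
  move=> i; case: (bet0 i) => [[-> _]|br]; first by exists 0; rewrite zero_lfunE.
  exact: (root_integrality k_neq0 dm br).
pose d := (\sum_i `|q i| ^ 2)%N.
have dE : trace_form z z = d%:R.
  rewrite /trace_form natr_sum; apply: eq_bigr => i _; rewrite qE -rmorphM -expr2.
  by rewrite -abszX pmulrn gez0_abs // sqr_ge0.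
have [i0 bi0] := root_index bX betX ar.
exists d; last first.
  by move=> u; rewrite /trace_form cE -dE /trace_form cE az; ring.
rewrite /d (bigD1 i0) //= addn_gt0 expn_gt0 absz_gt0.
have : (q i0)%:~R = 2%:R :> K by rewrite -qE bi0.
by case: (q i0 =P 0) => [->|//] /esym/eqP; rewrite pnatr_eq0.
Qed.

(** The base consists of roots and spans the dual of [h], so every functional vanishes at [w]. *)
Lemma roots_separate w : (forall i, (bet i w : K) = 0) -> w = 0.
Proof.
move=> bw.
have gw (gam : dual) : gam w = 0.
  have [bb rb _] := td_baseP td.
  have -> := coord_basis (X := in_tuple (td_base td)) bb (memvf gam).
  rewrite sum_lfunE big1 // => j _; rewrite scale_lfunE.
  have /(root_index bX betX)[i <-] := rb _ (mem_nth 0 (ltn_ord j)).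
  by rewrite bw scaler0.
rewrite (coord_vbasis (memvf w)) big1 // => j _.
by have := gw (linfun (coord (vbasis fullv) j : subvs_of h -> K^o)); rewrite lfunE /= => ->;
  rewrite scale0r.
Qed.

Lemma index_datum i : exists z m d, [/\ bet i != 0 -> coroot_datum (bet i) z m,
  bet i = 0 -> z = 0, (0 < d)%N & forall u, 2%:R * trace_form u z = d%:R * (bet i u : K)].
Proof.
case: (eqVneq (bet i) 0) => [b0|b0].
  (* Placeholder for indices with [bet i = 0], for which both sides of the identity vanish. *)
  exists 0, 0, 1%N; split=> // u; rewrite b0 zero_lfunE mulr0 /trace_form big1 ?mulr0 // => j _.
  by rewrite linear0 mulr0.
have br : is_root (bet i) by case: (bet0 i) => // -[E _]; rewrite E eqxx in b0.
have [z [m dm]] := root_datum V_int Kk k_neq0 mu0P br.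
have [d d0 dE] := trace_form_coroot_datum dm.
by exists z, m, d; split=> // E; rewrite E eqxx in b0.
Qed.

(** * Descent of the norm and boundedness of the functional *)

Section Descent.
Variables (zc : 'I_n -> subvs_of h) (mm : 'I_n -> int) (dd : 'I_n -> nat).
Hypotheses (zc_datum : forall i, bet i != 0 -> coroot_datum (bet i) (zc i) (mm i))
  (zc0 : forall i, bet i = 0 -> zc i = 0) (dd0 : forall i, (0 < dd i)%N)
  (trace_form_zc : forall i u, 2%:R * trace_form u (zc i) = (dd i)%:R * (bet i u : K)).

(** The products clear all the factors [dd i / 2] at once, so that one scalar serves every index. *)
Definition kscale : nat := (\prod_i dd i)%N.
Definition zscale i : nat := (2 * \prod_(j | j != i) dd j)%N.
(* zs i represents kscale times bet i with respect to the trace form; the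
   scaling makes the weights of V integer valued on it *)
Definition zs i : subvs_of h := (zscale i)%:R *: zc i.

Lemma kscale_gt0 : (0 < kscale)%N.
Proof. by rewrite prodn_gt0. Qed.
Lemma zscale_gt0 i : (0 < zscale i)%N.
Proof. by rewrite muln_gt0 prodn_gt0. Qed.

Lemma trace_form_zs i u : trace_form u (zs i) = kscale%:R * (bet i u : K).
Proof.
rewrite trace_formZr /zscale natrM -mulrA mulrCA trace_form_zc mulrCA mulrA.
by rewrite /kscale [in RHS](bigD1 i) //= natrM.
Qed.

(** The matrix [bet i (zs j)] is symmetric, so pairing the sum of the [bet i (zs j) *: zs j] with a
    root gives a value of the trace form; [roots_separate] then identifies that sum. *)
Lemma zs_dual (gam : dual) i :
  \sum_j (bet i (zs j) : K) * (gam (zs j) : K) = kscale%:R * (gam (zs i) : K).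
Proof.
have Es : (kscale%:R : K) != 0 by rewrite pnatr_eq0 -lt0n kscale_gt0.
have sym a b : (bet a (zs b) : K) = bet b (zs a).
  by apply: (mulfI Es); rewrite -!trace_form_zs trace_formC.
suff E : \sum_j (bet i (zs j) : K) *: zs j = kscale%:R *: zs i.
  have := congr1 gam E; rewrite linearZ linear_sum /= => EE; apply: etrans EE.
  by apply: eq_bigr => j _; rewrite [RHS]linearZ.
apply/eqP; rewrite -subr_eq0; apply/eqP; apply: roots_separate => l.
rewrite linearB linear_sum; apply/eqP; rewrite subr_eq0; apply/eqP.
transitivity (trace_form (zs i) (zs l)).
  by apply: eq_bigr => j _; rewrite [LHS]linearZ /= (sym i j) (sym l j).
by rewrite trace_form_zs [RHS]linearZ /= sym.
Qed.

(** Up to the factor [kscale ^ 2], the quadratic form dual to the trace form, written as a sum of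
    squares to be visibly a natural number on weights. *)
Definition qnorm (gam : dual) : K := \sum_j (gam (zs j) : K) ^+ 2.

Lemma qnorm_shift (gam : dual) i (a : K) : qnorm (gam + a *: bet i) =
  qnorm gam + kscale%:R * (2%:R * a * (gam (zs i) : K) + a ^+ 2 * (bet i (zs i) : K)).
Proof.
rewrite /qnorm.
transitivity (\sum_j ((gam (zs j) : K) ^+ 2 + (2%:R * a * ((bet i (zs j) : K) * (gam (zs j) : K))
    + a ^+ 2 * ((bet i (zs j) : K) * (bet i (zs j) : K)))) ).
  apply: eq_bigr => j _; rewrite add_lfunE scale_lfunE -[a *: _]/(a * (bet i (zs j) : K)).
  by rewrite expr2; ring.
rewrite !big_split /= -!mulr_sumr !zs_dual; ring.
Qed.

Lemma wt_zc_int mu i : is_wt mu -> exists p : int, (wt_fin mu (zc i) : K) = p%:~R.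
Proof.
move=> muP; case: (eqVneq (bet i) 0) => [/zc0 ->|/zc_datum dm].
  by exists 0; rewrite linear0.
by rewrite wt_finE; exact: (datum_int V_int Kk dm muP).
Qed.

Lemma qnorm_nat mu : is_wt mu -> exists r : nat, qnorm (wt_fin mu) = r%:R.
Proof.
move=> muP; have /choice[p pE] := fun i => wt_zc_int i muP.
exists (\sum_j `|((zscale j)%:Z * p j)%R| ^ 2)%N; rewrite natr_sum; apply: eq_bigr => j _.
rewrite linearZ /= pE -abszX [RHS]pmulrn gez0_abs ?sqr_ge0 // rmorphXn rmorphM /=.
by rewrite -pmulrn.
Qed.

Variables (eps : int) (ht : dual -> K) (hh : 'I_n -> int) (D : int).
Variable al0 : dual.
Hypothesis al0_root : is_root al0.
Hypotheses (D0 : 0 < D) (eps1 : eps = 1 \/ eps = -1)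
  (eps_datum : forall al z m, coroot_datum al z m -> 0 < - eps * m)
  (ht_lin : forall a al be, ht (a *: al + be) = a * ht al + ht be)
  (ht_bet : forall i, ht (bet i) = (hh i)%:~R) (hhD : forall i, `|hh i| < D).

Definition wt_at (gam : dual) (N H : int) : Prop :=
  is_wt (mu0 + wt_shift gam (eps * N)) /\ ht gam = H%:~R.

(** At the coroot of a bet_i - eps delta the weight takes the value [a * p + eps * mm i], which is
    [a * p] minus the absolute value of [mm i], so [datum_move] applies. *)
Lemma wt_at_move gam N H i a (p : int) : wt_at gam N H -> a = 1 \/ a = -1 ->
  bet i != 0 -> (wt_fin (mu0 + wt_shift gam (eps * N)) (zc i) : K) = p%:~R ->
  `|mm i| < a * p -> wt_at (gam + (- a%:~R) *: bet i) (N + 1) (H - a * hh i).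
Proof.
move=> [muP htg] a1 bi pE lt_p; split; last first.
  by rewrite addrC ht_lin ht_bet htg rmorphB rmorphM /=; ring.
have dm : coroot_datum (a%:~R *: bet i) (a%:~R *: zc i) (mm i).
  case: a1 lt_p => -> _; first by rewrite !scale1r; exact: zc_datum.
  by rewrite rmorphN !scaleN1r; apply: datum_opp; exact: zc_datum.
have /(datum_move (n := - eps) (p := a * p) V_int Kk dm muP) :
  (mu0 + wt_shift gam (eps * N)) (hz (a%:~R *: zc i)) = (a * p)%:~R :> K.
  by rewrite -wt_finE linearZ /= pE rmorphM.
rewrite wt_shiftN -addrA wt_shiftD -scaleNr opprK mulrDr mulr1; apply.
have := eps_datum dm; case: eps1 => ->; lia.
Qed.

(** Since [bet i] is 2 at [zc i], the norm changes by a positive multiple of [1 - a * p]. *)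
Lemma qnorm_move mu i a (p : int) : a = 1 \/ a = -1 -> bet i != 0 ->
  (wt_fin mu (zc i) : K) = p%:~R -> 1 < a * p ->
  qnorm (wt_fin mu + (- a%:~R) *: bet i) < qnorm (wt_fin mu).
Proof.
move=> a1 bi pE p1; have [_ biz _ _] := zc_datum bi.
have E1 : (wt_fin mu (zs i) : K) = (zscale i)%:R * p%:~R by rewrite linearZ /= pE.
have E2 : (bet i (zs i) : K) = (zscale i)%:R * 2%:R by rewrite linearZ /= biz.
rewrite qnorm_shift gtrDl E1 E2.
have -> : 2%:R * - a%:~R * ((zscale i)%:R * p%:~R) +
    (- a%:~R) ^+ 2 * ((zscale i)%:R * 2%:R) = (zscale i)%:R * (2 * (1 - a * p))%:~R :> K.
  by case: a1 => ->; rewrite !(rmorphM, rmorphB, rmorphN) /=; ring.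
by rewrite !pmulr_rlt0 ?ltr0n ?kscale_gt0 ?zscale_gt0 // ltrz0; lia.
Qed.

Definition mbound : int := \sum_i `|mm i|.

(* If the coordinate of a weight mu at the coroot of al exceeds that of K at
   the affine coroot, then mu - al + eps delta is a weight of smaller norm. *)
Lemma wt_at_descent gam N H : wt_at gam N H -> exists gam' N' H',
  [/\ wt_at gam' N' H', D * N + eps * H <= D * N' + eps * H' &
   forall i, exists p : int, `|p| <= mbound /\
     (wt_fin (mu0 + wt_shift gam' (eps * N')) (zc i) : K) = p%:~R].
Proof.
move=> wgam; have [r] := qnorm_nat wgam.1.
elim/ltn_ind: r gam N H wgam => r IH gam N H wgam rE.
have /choice[p pE] := fun i => wt_zc_int i wgam.1.
have [box|/existsNP[i /negP]] := pselect (forall i, `|p i| <= mbound).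
  by exists gam, N, H; split=> // i; exists (p i).
rewrite -ltNge => lt_p.
have mi : `|mm i| <= mbound.
  by rewrite /mbound (bigD1 i) //= lerDl; apply: sumr_ge0.
have bi : bet i != 0.
  apply/eqP => /zc0 zi; have := pE i; rewrite zi linear0 => /esym/eqP.
  by rewrite intr_eq0 => /eqP p0; move: lt_p; rewrite p0; lia.
have [a [a1 ap]] : exists a : int, (a = 1 \/ a = -1) /\ a * p i = `|p i|.
  by case: (lerP 0 (p i)) => ?; [exists 1|exists (-1)]; split; auto; lia.
have m0 : mm i != 0 by case: (zc_datum bi).
have lt_mp : `|mm i| < a * p i by lia.
have w1 := wt_at_move wgam a1 bi (pE i) lt_mp.
have [r' r'E] := qnorm_nat w1.1.
have lt_r : (r' < r)%N.
  rewrite -(ltr_nat K) -rE -r'E !wt_fin_shift addrA -(wt_fin_shift mu0 gam (eps * N)).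
  by apply: qnorm_move (pE i) _ => //; lia.
have [gam' [N' [H' [w' le' box']]]] := IH r' lt_r _ _ _ w1 r'E.
exists gam', N', H'; split=> //; apply: le_trans le'.
(* The move adds [D - eps * a * hh i] to the functional, positive by the choice of [D]. *)
have := hhD i; case: a1 eps1 => -> [] ->; lia.
Qed.

(** Expanding [gam] in the base represents it through the trace form by an element [u] of [h]; if
    [gam] vanishes on the coroots, all roots vanish at [u]. *)
Lemma zc_separate (gam : dual) : (forall i, (gam (zc i) : K) = 0) -> gam = 0.
Proof.
move=> gz; have [bb rb _] := td_baseP td.
have /choice[ix ixE] : forall j : 'I_(size (td_base td)), exists i, bet i = (td_base td)`_j.
  by move=> j; apply: (root_index bX betX); apply: rb; rewrite mem_nth.
pose c j := coord (in_tuple (td_base td)) j gam.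
pose u := \sum_j c j *: zs (ix j).
have Es : (kscale%:R : K) != 0 by rewrite pnatr_eq0 -lt0n kscale_gt0.
have uE w : trace_form w u = kscale%:R * (gam w : K).
  have -> : (gam w : K) = \sum_j c j * (bet (ix j) w : K).
    rewrite [in LHS](coord_basis (X := in_tuple (td_base td)) bb (memvf gam)).
    by rewrite sum_lfunE; apply: eq_bigr => j _; rewrite scale_lfunE ixE.
  rewrite /trace_form mulr_sumr.
  transitivity (\sum_i \sum_j c j * ((bet i w : K) * (bet i (zs (ix j)) : K))).
    apply: eq_bigr => i _; rewrite linear_sum mulr_sumr; apply: eq_bigr => j _.
    by rewrite [X in _ * X]linearZ mulrCA.
  rewrite exchange_big; apply: eq_bigr => j _.
  by rewrite -mulr_sumr -/(trace_form _ _) trace_form_zs mulrCA.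
have u0 : u = 0.
  apply: roots_separate => l; apply: (mulfI Es).
  by rewrite -trace_form_zs trace_formC uE linearZ /= gz scaler0 !mulr0.
by apply/lfunP => w; apply: (mulfI Es); rewrite -uE u0 zero_lfunE mulr0 /trace_form big1 // => i _;
  rewrite linear0 mulr0.
Qed.

(** The box holds finitely many tables of coroot values. A table determines [gam] and hence [H], and
    for fixed [gam] the coefficient [N] is bounded by [delta_bounded]. *)
Lemma box_bounded : exists b : int, forall gam N H, wt_at gam N H ->
  (forall i, exists p : int, `|p| <= mbound /\
     (wt_fin (mu0 + wt_shift gam (eps * N)) (zc i) : K) = p%:~R) ->
  D * N + eps * H <= b.
Proof.
(* Values between [- mbound] and [mbound] are stored shifted by [mbound]. *)
pose T := {ffun 'I_n -> 'I_(`|mbound|.*2.+1)}.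
pose at_box (f : T) gam (N : int) := forall i,
  (wt_fin (mu0 + wt_shift gam (eps * N)) (zc i) : K) = ((f i : nat)%:Z - mbound)%:~R.
have mb0 : 0 <= mbound by apply: sumr_ge0.
have /choice[bnd bndP] : forall f : T, exists b : int, forall gam N H,
    wt_at gam N H -> at_box f gam N -> D * N + eps * H <= b.
  move=> f; have [[gam [N [H [wg fg]]]]|none] :=
    pselect (exists gam N H, wt_at gam N H /\ at_box f gam N); last first.
    by exists 0 => gam N H w fg; case: none; exists gam, N, H.
  have [z0 [m0 dm0]] := root_datum V_int Kk k_neq0 mu0P al0_root.
  have [N0 N0P] := delta_bounded V_int Kk dm0 wg.1 (eps_datum dm0).
  exists (D * (N + `|N0|) + eps * H) => gam2 N2 H2 w2 fg2.
  have E : gam2 = gam.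
    apply/eqP; rewrite -subr_eq0; apply/eqP; apply: zc_separate => i.
    have := fg2 i; rewrite -(fg i) !wt_fin_shift !add_lfunE => /addrI E2.
    by rewrite opp_lfunE E2 subrr.
  have EH : H2 = H by apply/eqP; rewrite -(eqr_int K) -w2.2 E wg.2.
  rewrite EH lerD2r ler_pM2l //.
  apply/negPn/negP; rewrite -ltNge => lt_N; apply: (N0P (N2 - N)); first by lia.
  have EN : eps * N + eps * (N2 - N) = eps * N2 by ring.
  by rewrite -addrA wt_shiftD addr0 EN -E; exact: w2.1.
exists (\sum_f `|bnd f|) => gam N H w /choice[p pE].
pose f : T := [ffun i => inord `|(p i + mbound)%R|%N].
apply: (le_trans (bndP f gam N H w _)).
  move=> i; rewrite (pE i).2 ffunE inordK; last by have := (pE i).1; lia.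
  suff -> : `|(p i + mbound)%R|%N%:Z - mbound = p i by [].
  by have := (pE i).1; lia.
rewrite (bigD1 f) //= (le_trans (ler_norm _)) // lerDl.
by apply: sumr_ge0.
Qed.

(** Descent into the box bounds the integer functional on all weights [wt_at]; minimizing its
    distance to the bound gives a maximizer. *)
Lemma maximal_wt_at : exists mu, is_wt mu /\ forall gam N H, ht gam = H%:~R ->
  0 < D * N + eps * H -> ~ is_wt (mu + wt_shift gam (eps * N)).
Proof.
have [b bP] := box_bounded.
have bnd gam N H : wt_at gam N H -> D * N + eps * H <= b.
  by move/wt_at_descent => [gam' [N' [H' [w le box]]]]; apply: le_trans le (bP _ _ _ w box).
pose P r := `[< exists gam N H, wt_at gam N H /\ b - (D * N + eps * H) = r%:Z >].
have exP : exists r, P r.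
  exists `|b|%N; apply/asboolP; exists 0, 0, 0.
  have ht0 : ht 0 = 0.
    by have := ht_lin (-1) 0 0; rewrite scaler0 addr0 mulN1r addNr.
  have w0 : wt_at 0 0 0 by split; rewrite ?mulr0 ?wt_shift0 ?addr0.
  by split=> //; have := bnd _ _ _ w0; lia.
case: (ex_minnP exP) => r /asboolP[gam [N [H [wg rE]]]] r_min.
exists (mu0 + wt_shift gam (eps * N)); split; first exact: wg.1.
move=> gam' N' H' htg' pos'; rewrite -addrA wt_shiftD -mulrDr => wt'.
have w' : wt_at (gam + gam') (N + N') (H + H').
  split=> //; have := ht_lin 1 gam gam'.
  by rewrite scale1r mul1r rmorphD /= wg.2 htg'.
have le' := bnd _ _ _ w'.
have : P `|(b - (D * (N + N') + eps * (H + H')))%R|%N.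
  by apply/asboolP; exists (gam + gam'), (N + N'), (H + H'); split=> //; lia.
by move/r_min; lia.
Qed.

End Descent.
End Eigenbasis.

(** * Heights of roots and the extremal weight *)

Definition height (gam : dual) : K := \sum_i coord (in_tuple (td_base td)) i gam.

Lemma heightP a (al be : dual) : height (a *: al + be) = a * height al + height be.
Proof.
rewrite /height mulr_sumr -big_split; apply: eq_bigr => i _ /=.
by rewrite linearP.
Qed.

Lemma height_nneg al : nneg_comb (td_base td) al -> al != 0 ->
  exists H : nat, (0 < H)%N /\ height al = H%:R.
Proof.
move=> [c alE] al0; have [bb _ _] := td_baseP td.
have cE j : coord (in_tuple (td_base td)) j al = (c j)%:R.
  rewrite alE; under eq_bigr do rewrite -scaler_nat.
  exact: (coord_sum_free (X := in_tuple (td_base td)) _ _ (basis_free bb)).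
exists (\sum_i c i)%N; split; last by rewrite natr_sum; apply: eq_bigr => j _; rewrite cE.
rewrite lt0n; apply: contraNneq al0 => /eqP; rewrite sum_nat_eq0 => /forallP c0.
by rewrite alE big1 // => i _; rewrite (eqP (c0 i)) mulr0n.
Qed.

Lemma root_height al : is_root al -> exists H : int, height al = H%:~R.
Proof.
move=> ar; have [_ _ /(_ al ar)] := td_baseP td; have al0 := ar.1.
case=> [/height_nneg/(_ al0)|/height_nneg]; first by case=> H [_ ->]; exists H.
rewrite oppr_eq0 => /(_ al0)[H [_ HE]]; exists (- H%:Z).
have height0 : height 0 = 0 by rewrite /height big1 // => i _; rewrite linear0.
have := heightP (-1) al 0; rewrite addr0 scaleN1r HE mulN1r height0 addr0 => E.
by rewrite rmorphN /= -[height al]opprK -E.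
Qed.

(** The three exclusions cover the weights of all generators of [affVir_pos] or [affVir_neg],
    according to [eps]. *)
Lemma extremal_weight al0 : k != 0 -> is_root al0 -> exists eps : int,
  (eps = 1 \/ eps = -1) /\ exists mu, [/\ is_wt mu,
    forall N : int, 0 < N -> ~ is_wt (mu + wt_shift 0 (eps * N)),
    forall al (N : int), is_root al -> 0 < N -> ~ is_wt (mu + wt_shift al (eps * N)) &
    forall al, is_root al -> nneg_comb (td_base td) (eps%:~R *: al) ->
      ~ is_wt (mu + wt_shift al 0)].
Proof.
move=> k0 al0r; have [eps [eps1 eps_datum]] := level_sign k0 al0r.
exists eps; split=> //.
have [n [X [bet [bX betX]]]] := root_eigenbasis td.
have betX1 i := (betX i).1; have betX2 i := (betX i).2.
have /choice[zc /choice[mm /choice[dd all_datum]]] := index_datum k0 bX betX1 betX2.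
have height0 : height 0 = 0 by rewrite /height big1 // => i _; rewrite linear0.
have /choice[hh hhE] : forall i, exists H : int, height (bet i) = H%:~R.
  move=> i; case: (betX2 i) => [[-> _]|/root_height//].
  by exists 0; rewrite height0.
(* Any [N > 0] then outweighs the height of a root, and at [N = 0] the sign of the height
   decides. *)
pose D : int := \sum_i `|hh i| + 1.
have hhD i : `|hh i| < D.
  by rewrite /D (bigD1 i) //= -addrA ltrDl; apply: ltr_wpDl => //; apply: sumr_ge0.
have D0 : 0 < D by apply: ltr_wpDl => //; apply: sumr_ge0.
have [mu [muP mu_max]] := maximal_wt_at k0 bX betX1
  (fun i => let: And4 p _ _ _ := all_datum i in p)
  (fun i => let: And4 _ p _ _ := all_datum i in p)
  (fun i => let: And4 _ _ p _ := all_datum i in p)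
  (fun i => let: And4 _ _ _ p := all_datum i in p)
  al0r D0 eps1 eps_datum heightP hhE hhD.
exists mu; split=> //.
- by move=> N N0; apply: (mu_max _ _ 0); rewrite ?height0 // mulr0 addr0 mulr_gt0.
- move=> al N ar N0; have [i <-] := root_index bX betX1 ar.
  apply: (mu_max _ _ _ (hhE i)); have := hhD i.
  have : D <= D * N by apply: ler_peMr; lia.
  by case: eps1 => ->; lia.
- move=> al ar nn; have [i bi] := root_index bX betX1 ar.
  have [|H [H0 HE]] := height_nneg nn.
    by rewrite scaler_eq0 intr_eq0 (negPf ar.1) orbF; case: eps1 => ->.
  have := mu_max (bet i) 0 (hh i) (hhE i); rewrite !mulr0 add0r bi; apply.
  rewrite -(ltr_int K) rmorphM /= -hhE bi -[_ * _]addr0 -height0 -heightP addr0 HE.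
  by rewrite ltr0n.
Qed.

End ExtremalWeight.

(** * From an extremal weight to a highest or lowest weight vector *)

Section Assembly.
Variables (K : numFieldType) (g : finLieAlgType K) (B : invariant_form g).
Variables (td : triangular_decomposition g) (A : comAlgType K).
Variables (V : lmodType K) (rho : lie_module (loop_affVir B A) V).
Local Notation h := (td_h td).
Local Notation dual := 'Hom(subvs_of h, K^o).
Local Notation weight := 'Hom(hbar td, K^o).
Local Notation wsp := (@weight_space K g B td A V rho).
Local Notation is_wt := (@is_wt K g B td A V rho).

(** Without roots [g] would equal its abelian subalgebra [h]. *)
Lemma simple_has_root : simple_lie g -> exists al : dual, is_root al.
Proof.
move=> [[x [y xy]] _].
have [n [X [bet [bX betX]]]] := root_eigenbasis td.
have [//|noroot] := pselect (exists al : dual, is_root al).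
have inh w : w \in h.
  rewrite (coord_basis bX (memvf w)); apply: memv_suml => i _; apply: memvZ.
  by case: (betX i).2 => [[]//|ri]; case: noroot; exists (bet i).
by rewrite (td_abelian (inh x) (inh y)) eqxx in xy.
Qed.

Lemma weight_module_has_wt (v : V) : weight_module td rho -> v != 0 -> exists mu, is_wt mu.
Proof.
move=> [decomp _] v0; have [s [w [ww vE]]] := decomp v.
apply: contra_notP (negP v0) => nwt; apply/eqP; rewrite vE big1 // => mu _.
by apply/eqP/negPn/negP => w0; apply: nwt; exists mu, (w mu).
Qed.

(** K ⊗ 1 is central, so its eigenspace for the eigenvalue at a weight vector is a nonzero
    submodule. *)
Lemma irreducible_affK_scalar mu : irreducible rho -> is_wt mu ->
  forall v, tact rho 1 (affK B) v = (mu (hK td) : K) *: v.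
Proof.
move=> [_ irr] [v0 [v0n0 v0mu]] v.
pose W : set V := [set v | tact rho 1 (affK B) v = (mu (hK td) : K) *: v].
have subW : submodule rho W.
  split; first by rewrite /W /= linear0 scaler0.
    by move=> a u w; rewrite /W /= linearP /= => -> ->; rewrite scalerDr !scalerA mulrC.
  rewrite /W => x w /= Ww.
  elim/lin_span_ind: (tensor_span x) => [|a y y' [X [b ->]] IH].
    by rewrite (bilin0l (lact_bilin rho)) linear0 scaler0.
  rewrite (bilinPl (lact_bilin rho)) linearP /= IH scalerDr; congr (_ + _).
  have := tact_br rho 1 b (affK B) X w; rewrite br_affKl tact0 => /esym/eqP.
  rewrite subr_eq0 -/(tact rho b X w) => /eqP ->.
  by rewrite Ww linearZ !scalerA mulrC.
case: (irr W subW) => [W0|WT]; last by have : W v by rewrite WT.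
have : W v0 by exact: wsp_K.
by rewrite W0 /= => E; rewrite E eqxx in v0n0.
Qed.

Lemma irreducible_cyclic (v : V) : irreducible rho -> v != 0 -> cyclic_submodule rho v = setT.
Proof.
move=> [_ irr] v0; have [||//] := irr (cyclic_submodule rho v).
  split; first exact: lin_span0.
    by move=> a u w ? ?; apply: lin_spanD => //; exact: lin_spanZ.
  move=> x w; elim/lin_span_ind => [|a y y' [s ->] IH].
    by rewrite (bilin0r (lact_bilin rho)); exact: lin_span0.
  rewrite (bilinPr (lact_bilin rho)); apply: lin_spanP => //.
  by exists (x :: s).
move=> E; have : cyclic_submodule rho v v by apply: sub_lin_span; exists [::].
by rewrite E /= => v00; rewrite v00 eqxx in v0.
Qed.

Lemma not_wt_kill mu (chi : weight) (X : affVir B) (a : A) v :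
  wsp mu v -> eigen_of X chi -> ~ is_wt (mu + chi) ->
  tact rho a X v = 0.
Proof.
move=> muv Xchi nwt; apply: contra_notP nwt => /eqP Xv.
by exists (tact rho a X v); split=> //; exact: wsp_shift.
Qed.

Lemma lin_span_kill a (S : set (affVir B)) v :
  (forall X, S X -> tact rho a X v = 0) -> forall X, lin_span S X -> tact rho a X v = 0.
Proof.
move=> S0 X; elim/lin_span_ind => [|c Y Z SY IH]; first exact: tact0.
by rewrite tactP IH S0 // scaler0 addr0.
Qed.

Lemma current_of_kill (S : set (affVir B)) v :
  (forall a X, S X -> tact rho a X v = 0) ->
  forall x, @current_of K g B A S x -> rho x v = 0.
Proof.
move=> S0 x; elim/lin_span_ind => [|c y z [X [a [SX ->]]] IH].
  exact: (bilin0l (lact_bilin rho)).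
by rewrite (bilinPl (lact_bilin rho)) IH -/(tact rho a X v) S0 // scaler0 addr0.
Qed.

(** Split [x] along [h] and the root spaces: the pieces shift [mu] by n delta or al + n delta. *)
Lemma loop_nonzero_mode_kill mu v a (n : int) x : wsp mu v ->
  ~ is_wt (mu + wt_shift 0 n) -> (forall al : dual, is_root al -> ~ is_wt (mu + wt_shift al n)) ->
  tact rho a (loop_elt B x n) v = 0.
Proof.
move=> muv nwt0 nwt.
elim/lin_span_ind: (td_span td x) => [|c y z yE IH]; first by rewrite loop_elt0 tact0.
rewrite loop_eltP tactP IH addr0; suff -> : tact rho a (loop_elt B y n) v = 0 by rewrite scaler0.
case: yE => [yh|[al [ar ay]]]; last first.
  exact: (not_wt_kill a muv (eigen_loop B n ay) (nwt al ar)).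
apply: (not_wt_kill a muv _ nwt0); apply: eigen_loop => u.
by rewrite (td_abelian (subvsP u) yh) zero_lfunE scale0r.
Qed.

Lemma loop_span_kill mu v a (P : dual -> Prop) x : wsp mu v ->
  (forall al, P al -> ~ is_wt (mu + wt_shift al 0)) ->
  lin_span [set y | exists al, P al /\ root_space al y] x ->
  tact rho a (loop_elt B x 0) v = 0.
Proof.
move=> muv nwt; elim/lin_span_ind => [|c y z [al [Pal ay]] IH].
  by rewrite loop_elt0 tact0.
rewrite loop_eltP tactP IH addr0.
by rewrite (not_wt_kill a muv (eigen_loop B 0 ay) (nwt al Pal)) scaler0.
Qed.

Lemma irreducible_integrable_extremal :
  simple_lie g -> irreducible rho -> integrable td rho ->
  (exists v, rho (affK B ⊗ (1 : A)) v <> 0) ->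
  highest_weight_module td rho \/ lowest_weight_module td rho.
Proof.
move=> g_simple V_irr V_int [v1 Kv1].
have [V_wt _ _] := V_int; have [[v0 v0n0] _] := V_irr.
have [mu0 mu0P] := weight_module_has_wt V_wt v0n0.
have Kk := irreducible_affK_scalar V_irr mu0P.
have k0 : (mu0 (hK td) : K) != 0.
  by apply: contra_notN Kv1 => /eqP k0; rewrite -/(tact rho 1 _ _) Kk k0 scale0r.
have [al0 al0r] := simple_has_root g_simple.
have [eps [eps1 [mu [[v [v0' muv]] nwt0 nwtn nwt]]]] :=
  extremal_weight V_int Kk mu0P k0 al0r.
(* For [eps = 1] every generator of [affVir_pos] sends [v] to an excluded weight, and for [eps = -1]
   every generator of [affVir_neg] does. *)
case: eps1 nwt0 nwtn nwt => -> nwt0 nwtn nwt; [left|right]; split=> //;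
  exists mu, v; split=> //; try exact: irreducible_cyclic; apply: current_of_kill => a;
  apply: lin_span_kill => X [[[x xn ->]|[x [n [n0 ->]]]]|[n [n0 ->]]].
- apply: (loop_span_kill a muv _ ((td_nposP td x).1 xn)) => al [ar nn].
  by apply: nwt => //; rewrite scale1r.
- apply: (loop_nonzero_mode_kill a x muv) => [|al ar].
    by have := nwt0 n n0; rewrite mul1r.
  by have := nwtn al n ar n0; rewrite mul1r.
- apply: (not_wt_kill a muv (eigen_vird B n)).
  by have := nwt0 n n0; rewrite mul1r.
- apply: (loop_span_kill a muv _ ((td_nnegP td x).1 xn)) => al [ar nn].
  by apply: nwt => //; rewrite rmorphN scaleN1r.
- have n0' : 0 < - n by rewrite oppr_gt0.
  apply: (loop_nonzero_mode_kill a x muv) => [|al ar].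
    by have := nwt0 _ n0'; rewrite mulN1r opprK.
  by have := nwtn al _ ar n0'; rewrite mulN1r opprK.
- apply: (not_wt_kill a muv (eigen_vird B n)).
  by have := nwt0 (- n); rewrite mulN1r opprK oppr_gt0; apply.
Qed.

End Assembly.

Theorem proposition2p7 (R : realType) (g : finLieAlgType R[i])
  (g_simple : simple_lie g) (td : triangular_decomposition g)
  (B : invariant_form g)
  (A : comAlgType R[i]) (A_fg : finitely_generated A)
  (V : lmodType R[i]) (rho : lie_module (loop_affVir B A) V)
  (V_irr : irreducible rho) (V_int : integrable td rho)
  (K_nontrivial : exists v : V, rho (affK B ⊗ (1 : A)) v <> 0) :
  highest_weight_module td rho \/ lowest_weight_module td rho.
Proof. exact: (irreducible_integrable_extremal g_simple V_irr V_int K_nontrivial). Qed.
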